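(* Let $G$ be a finite abelian group. Every tame split decomposition configuration $(G,\mathcal T,\mathcal Z)$ is realizable over $\mathbb{Q}$. In particular, every tame ramification configuration $(G,\mathcal T)$ is realizable over $\mathbb{Q}$.
   Context: For a finite group $G$, $\operatorname{rank}(G)=s$ is the minimal number of elements which with their conjugates generate $G$. A (minimal) tame ramification configuration is a pair $(G,\mathcal T)$, $\mathcal T=\{T_1,\dots,T_s\}$ cyclic subgroups which with their conjugates generate $G$. A (minimal) tame decomposition configuration is $(G,\mathcal T,\mathcal Z)$ with $\mathcal Z=\{Z_1,\dots,Z_s\}$ subgroups, $T_i\trianglelefteq Z_i$, $Z_i/T_i$ cyclic; it is a tame split decomposition configuration if $Z_i=T_i$ for all $i$. Realizable over $\mathbb{Q}$: there exist a tamely ramified finite Galois extension $K/\mathbb{Q}$ and an isomorphism $\varphi:\operatorname{Gal}(K/\mathbb{Q})\to G$ such that, with $p_1,\dots,p_s$ all the finite primes ramified in $K$ (suitably ordered), for each $i$ some prime $\wp_i$ of $K$ over $p_i$ has inertia group $T(\wp_i/(p_i))$ with $\varphi(T(\wp_i/(p_i)))=T_i$ (and, for decomposition configurations, decomposition group with $\varphi(Z(\wp_i/(p_i)))=Z_i$). *)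

(* Defs.v *)
From HB Require Import structures.
From mathcomp Require Import all_boot all_order all_algebra all_fingroup all_solvable all_field.
Set Implicit Arguments. Unset Strict Implicit. Unset Printing Implicit Defensive.
Import GRing.Theory.
Local Open Scope ring_scope.

Local Open Scope group_scope.

Definition normal_gen (gT : finGroupType) (G : {group gT}) (A : {set gT}) :=
  <<class_support A G>>.

Definition is_rank (gT : finGroupType) (G : {group gT}) (s : nat) : Prop :=
  (exists x : 'I_s -> gT, (forall i, x i \in G) /\
      normal_gen G [set x i | i : 'I_s] = G) /\
  (forall n (x : 'I_n -> gT), (forall i, x i \in G) ->
      normal_gen G [set x i | i : 'I_n] = G -> (s <= n)%N).

Definition tame_ram_config (gT : finGroupType) (G : {group gT}) (s : nat)
    (T : 'I_s -> {group gT}) : Prop :=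
  is_rank G s /\ (forall i, T i \subset G) /\ (forall i, cyclic (T i)) /\
  normal_gen G (\bigcup_(i < s) T i) = G.

Definition tame_dec_config (gT : finGroupType) (G : {group gT}) (s : nat)
    (T Z : 'I_s -> {group gT}) : Prop :=
  tame_ram_config G T /\ (forall i, Z i \subset G) /\
  (forall i, T i <| Z i) /\ (forall i, cyclic (Z i / T i)).

Definition tame_split_dec_config (gT : finGroupType) (G : {group gT}) (s : nat)
    (T Z : 'I_s -> {group gT}) : Prop :=
  tame_dec_config G T Z /\ (forall i, Z i = T i).

Local Close Scope group_scope.

Section NumberField.
Variable L : splittingFieldType rat.   (* a finite Galois extension of Q *)

Definition alg_int (x : L) : Prop :=
  exists p : {poly int}, p \is monic /\ root (map_poly (fun z : int => z%:~R) p) x.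

Definition prime_ideal (P : L -> Prop) : Prop :=
  (forall x, P x -> alg_int x) /\
  P 0 /\
  (forall x y, P x -> P y -> P (x + y)) /\
  (forall a x, alg_int a -> P x -> P (a * x)) /\
  ~ P 1 /\
  (forall x y, alg_int x -> alg_int y -> P (x * y) -> P x \/ P y) /\
  (exists x, x != 0 /\ P x).

Fixpoint ideal_pow (P : L -> Prop) (k : nat) : L -> Prop :=
  match k with
  | 0 => alg_int
  | k'.+1 => fun x => exists s : seq (L * L),
      (forall ab, ab \in s -> P ab.1 /\ ideal_pow P k' ab.2) /\
      x = \sum_(ab <- s) ab.1 * ab.2
  end.

Definition lies_over (P : L -> Prop) (p : nat) : Prop :=
  prime p /\ P (p%:R).

Definition ram_index (P : L -> Prop) (p e : nat) : Prop :=
  ideal_pow P e (p%:R) /\ ~ ideal_pow P e.+1 (p%:R).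

Definition ramified (p : nat) : Prop :=
  prime p /\ exists P, prime_ideal P /\ lies_over P p /\ ideal_pow P 2 (p%:R).

Definition tamely_ramified : Prop :=
  forall P p e, prime_ideal P -> lies_over P p -> ram_index P p e -> ~~ (p %| e)%N.

Definition in_decomposition (P : L -> Prop) (sigma : gal_of {: L}) : Prop :=
  forall x, P x <-> P (sigma x).

Definition in_inertia (P : L -> Prop) (sigma : gal_of {: L}) : Prop :=
  in_decomposition P sigma /\ (forall x, alg_int x -> P (sigma x - x)).

End NumberField.

Definition realizable_dec (gT : finGroupType) (G : {group gT}) (s : nat)
    (T Z : 'I_s -> {group gT}) : Prop :=
  exists (L : splittingFieldType rat)
         (phi : {morphism ('Gal({: L} / 1%VS))%g >-> gT}),
    isom ('Gal({: L} / 1%VS))%g G phi /\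
    tamely_ramified L /\
    exists p : 'I_s -> nat,
      injective p /\ (forall i, prime (p i)) /\
      (forall q, ramified L q <-> exists i, q = p i) /\
      (forall i, exists P, prime_ideal P /\ lies_over P (p i) /\
         (forall sigma : gal_of {: L}, in_inertia P sigma <-> phi sigma \in T i) /\
         (forall sigma : gal_of {: L}, in_decomposition P sigma <-> phi sigma \in Z i)).

Definition realizable_ram (gT : finGroupType) (G : {group gT}) (s : nat)
    (T : 'I_s -> {group gT}) : Prop :=
  exists (L : splittingFieldType rat)
         (phi : {morphism ('Gal({: L} / 1%VS))%g >-> gT}),
    isom ('Gal({: L} / 1%VS))%g G phi /\
    tamely_ramified L /\
    exists p : 'I_s -> nat,
      injective p /\ (forall i, prime (p i)) /\
      (forall q, ramified L q <-> exists i, q = p i) /\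
      (forall i, exists P, prime_ideal P /\ lies_over P (p i) /\
         (forall sigma : gal_of {: L}, in_inertia P sigma <-> phi sigma \in T i)).

(* Main.v *)
Require Import Defs.
From HB Require Import structures.
From mathcomp Require Import all_boot all_order all_algebra all_fingroup all_solvable all_field.
From mathcomp Require Import integral_char zify ring.
From mathcomp Require boolp classical_sets.
Set Implicit Arguments. Unset Strict Implicit. Unset Printing Implicit Defensive.
Import Order.TTheory GRing.Theory Num.Theory.
Local Open Scope ring_scope.

(** Write [T i = <[t i]>].  Choose distinct primes [p i = 1 mod #|G|], each of
    them a [#|G|]-th power modulo every other one; such a prime exists because
    the values of an integer polynomial have infinitely many prime divisors, so
    that some new prime splits in a given number field.  The characters
    [(Z/p i)^* -> <[t i]>] multiply to a surjection [(Z/n)^* -> G] with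
    [n = \prod_i p i], and [L] is the subfield of [M = Q(zeta_n)] fixed by its
    kernel.

    The arithmetic rests on one congruence.  For a prime [q] let [pi = q] if
    [q] does not divide [n], and [pi = 1 - zeta_p] if [q = p] is some [p i].
    The order [Z[zeta_n]] is maximal at [q], hence an automorphism which sends
    [zeta_n] to [zeta_n ^+ (q ^ e)] modulo [pi] is [x |-> x ^+ (q ^ e)] modulo
    [pi] on all algebraic integers of [M].  Some [q ^ e]-th power map is thus
    trivial modulo [pi], so [pi] generates every prime above [q] locally, which
    bounds the ramification index by [1] and by [p.-1] respectively; [e = 0]
    shows that [<[t i]>] acts as inertia, and [e = 1] shows that all residue
    fields of [L] above [p i] are prime, whence decomposition equals inertia.
    That inertia is not larger, and that [p i] does ramify, follows by testing
    traces of the [zeta_m ^+ b], where [n = p i * m], with the orthogonality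
    relations of the [m]-th roots of unity. *)

(** * Primes with prescribed power residues *)

(** Evaluate [('X ^+ n - 1) / ('X - 1)] at [1], once in factored form and once as a geometric
    sum. *)
Lemma prod_one_sub_prim_root (F : fieldType) (n : nat) (z : F) :
  n.-primitive_root z -> \prod_(1 <= i < n) (1 - z ^+ i) = n%:R.
Proof.
move=> zP; have n_gt0 := prim_order_gt0 zP.
have := factor_Xn_sub_1 zP; rewrite big_ltn // expr0 subrX1.
have nz : ('X - 1%:P : {poly F}) != 0 by rewrite polyXsubC_eq0.
move/(mulfI nz)/(congr1 (horner^~ 1)); rewrite horner_prod horner_sum.
under eq_bigr do rewrite hornerXsubC.
by move->; under eq_bigr do rewrite hornerXn expr1n; rewrite sumr_const card_ord.
Qed.

(** Euclid's argument: if the constant term [a] is nonzero, [f] at a multiple of [a * D] equals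
    [a * w] with [w] congruent to [1] modulo [D], so every prime divisor of [w] avoids [D]. *)
Lemma prime_dvd_poly_value (f : {poly int}) (D : nat) :
  (1 < size f)%N -> (0 < D)%N ->
  exists p m : nat, [/\ prime p, ~~ (p %| D)%N & (p%:Z %| f.[m%:Z])%Z].
Proof.
move=> sf D0; set a := f.[0].
have /factor_theorem[q] : root (f - a%:P) 0 by rewrite /root !hornerE subrr.
rewrite subr0 => /eqP; rewrite subr_eq => /eqP fE.
have q0 : q != 0.
  apply: contraTneq sf => q0; rewrite fE q0 mul0r add0r -leqNgt.
  exact: size_polyC_leq1.
have fx x : f.[x] = q.[x] * x + a by rewrite fE !hornerE.
have [a0|a0] := eqVneq a 0.
  have [p Dp pP] := prime_above D; exists p, p; split=> //.
    by rewrite gtnNdvd.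
  by rewrite fx a0 addr0 dvdz_mull.
pose v (y : nat) : nat := (`|a| * D * y)%N.
have v_inj : injective v.
  by move=> y y' /eqP; rewrite eqn_pmul2l ?muln_gt0 ?absz_gt0 ?a0 // => /eqP.
(* Among [size q] distinct arguments one is not a root of [q]; taking [y > 2] forces [w] below to
   have absolute value greater than [1]. *)
have [y y3 qy] : exists2 y : nat, (2 < y)%N & q.[(v y)%:Z] != 0.
  pose rs := [seq (v y)%:Z | y <- iota 3 (size q)].
  have [/(max_poly_roots q0)|/allPn[_ /mapP[y + ->]]] := boolP (all (root q) rs).
    rewrite size_map size_iota ltnn map_inj_uniq ?iota_uniq => [H|y y' []].
      by have := H isT.
    exact: v_inj.
  by rewrite mem_iota => /andP[y3 _]; exists y.
pose w : int := 1 + Num.sg a * (D * y)%N%:Z * q.[(v y)%:Z].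
have fw : f.[(v y)%:Z] = a * w.
  rewrite fx /w mulrDr mulr1 addrC; congr (_ + _); rewrite [RHS]mulrA [a * _]mulrA.
  rewrite [in a * _]mulrC -normrEsg mulrC; congr (_ * _).
  by rewrite /v -mulnA PoszM abszE.
have w1 : (1 < `|w|)%N.
  have : (2 < `|(Num.sg a * (D * y)%N%:Z * q.[(v y)%:Z])%R|)%N.
    rewrite !abszM absz_sg a0 mul1n (leq_trans y3) //= -mulnA.
    by rewrite (leq_trans _ (leq_pmull _ D0)) // leq_pmulr // absz_gt0.
  by rewrite /w; move: (_ * _) => u; lia.
exists (pdiv `|w|), (v y); have pP := pdiv_prime w1; split=> //; last first.
  by rewrite fw dvdz_mull //; apply: pdiv_dvd.
apply/negP => pD; have : ((pdiv `|w|)%:Z %| w)%Z by apply: pdiv_dvd.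
rewrite {2}/w rpredDr; last by rewrite dvdz_mulr // dvdz_mull //; apply: dvdn_mulr.
by rewrite dvdz1 /= => /eqP p1; rewrite p1 in pP.
Qed.

(* A prime [p] dividing [f.[m]] gives a reduction of [Z[t]] modulo [p] sending
   [t] to [m], except for the finitely many [p] dividing a denominator. *)
Lemma int_poly_specialization (t : algC) :
  exists2 f : {poly int}, (1 < size f)%N &
  forall h : {poly int}, root (map_poly intr h) t ->
  exists2 D : nat, (0 < D)%N & forall p m : nat, prime p -> ~~ (p %| D)%N ->
    (p%:Z %| f.[m%:Z] -> p%:Z %| h.[m%:Z])%Z.
Proof.
have [g [gE gM] gP] := minCpolyP t.
have [f [a a0 fE]] := rat_poly_scale g.
have intr0 : (intr 0 : rat) = 0 by [].
have fI : injective (map_poly (intr : int -> rat)).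
  by apply: map_inj_poly => //; exact: intr_inj.
have aQ0 : (a%:~R : rat) != 0 by rewrite intr_eq0.
have sf : size f = size (minCpoly t).
  rewrite gE size_map_poly fE size_scale ?invr_eq0 //.
  by rewrite size_map_inj_poly //; exact: intr_inj.
exists f; first by rewrite sf size_minCpoly.
move=> h; have -> : map_poly (intr : int -> algC) h = map_poly ratr (map_poly intr h).
  by rewrite -map_poly_comp; apply: eq_map_poly => b; rewrite /= ratr_int.
rewrite gP => /dvdpP[r]; have [s [b b0 ->]] := rat_poly_scale r.
have bQ0 : (b%:~R : rat) != 0 by rewrite intr_eq0.
rewrite fE -scalerAl -scalerAr scalerA -invfM => hE.
have {}hE : (a * b) *: h = s * f.
  apply: fI; rewrite rmorphM /= [X in X = _](map_polyZ intr) /= hE.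
  by rewrite scalerA [X in X *: _](_ : _ = 1) ?scale1r // intrM [b%:~R * _]mulrC divff // mulf_neq0.
(* The denominators [a] of the minimal polynomial and [b] of the cofactor give
   [(a * b) *: h = s * f] over the integers. *)
exists (absz (a * b : int)) => [|p m pP pD pf]; first by rewrite absz_gt0 mulf_neq0.
have := congr1 (horner^~ m%:Z) hE; rewrite hornerZ hornerM => e.
have : (p %| absz (a * b * h.[m%:Z])%R)%N by rewrite e abszM dvdn_mull.
by rewrite abszM Euclid_dvdM // (negPf pD).
Qed.

Lemma Fp_int_eq0 (p : nat) (z : int) : prime p -> ((z%:~R : 'F_p) == 0) = (p%:Z %| z)%Z.
Proof. by move=> pP; rewrite (dvdz_pcharf (pchar_Fp pP)). Qed.

Lemma Fp_nat_eqmod (p a b : nat) : prime p -> ((a%:R : 'F_p) == b%:R) = (a == b %[mod p])%N.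
Proof. by move=> pP; rewrite -val_eqE /= !val_Fp_nat. Qed.

(** Let [t] generate a field containing a primitive [N]-th root of unity and [N]-th roots of the
    members of [s]. A root of [f] modulo [p] reduces all these elements into ['F_p], up to finitely
    many bad [p]. *)
Lemma prime_split_roots (N : nat) (s : seq nat) (B : nat) : (0 < N)%N -> (0 < B)%N ->
  exists p, [/\ prime p, ~~ (p %| B)%N, (N %| p.-1)%N &
    forall x, x \in s -> exists y, (y ^ N = x %[mod p])%N].
Proof.
move=> N0 B0; have [z zP] := C_prim_root_exists N0.
have [t _ [ps sE]] := algC_PET (z :: [seq N.-root x%:R | x <- s]).
have tE e : e \in z :: [seq N.-root x%:R | x <- s] ->
    exists2 c : int, c != 0 & exists h : {poly int}, c%:~R * e = (map_poly intr h).[t].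
  rewrite sE => /mapP[g _ ->]; have [h [c c0 ->]] := rat_poly_scale g.
  exists c => //; exists h; rewrite map_polyZ hornerZ fmorphV /= ratr_int mulVKf ?intr_eq0 //.
  by congr horner; rewrite -map_poly_comp; apply: eq_map_poly => b; rewrite /= ratr_int.
have [f sf fP] := int_poly_specialization t.
(* [Q] holds at every prime that does not divide [D] and modulo which [f] has a root. *)
pose good (D : nat) (Q : nat -> Prop) := (0 < D)%N /\ forall p m : nat, prime p ->
  ~~ (p %| D)%N -> (p%:Z %| f.[m%:Z])%Z -> Q p.
have [Dz [Dz0 DzP]] : exists D, good D (fun p => (N %| p.-1)%N).
  have [//|c c0 [h hE]] := tE z; first by rewrite mem_head.
  pose g1 : {poly int} := h ^+ N - (c ^+ N)%:P.
  have [|D1 D10 D1P] := fP g1.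
    rewrite /root /g1 rmorphB rmorphXn /= map_polyC hornerD hornerN hornerC horner_exp -hE /=.
    by rewrite exprMn (prim_expr_order zP) mulr1 /= rmorphXn subrr.
  (* This encodes that the product of the [1 - z ^+ i] is [N], with denominators cleared by [c].
     Modulo [p] it excludes that the image of [z] has order less than [N]. *)
  pose g2 : {poly int} := \prod_(1 <= i < N) ((c ^+ i)%:P - h ^+ i)
    - (N%:Z * \prod_(1 <= i < N) c ^+ i)%:P.
  have [|D2 D20 D2P] := fP g2.
    rewrite /root /g2 rmorphB rmorph_prod /= map_polyC hornerD hornerN hornerC horner_prod /=.
    rewrite rmorphM rmorph_prod /= -[X in _ - X * _](prod_one_sub_prim_root zP).
    rewrite -big_split subr_eq0; apply/eqP/eq_bigr => i _.
    rewrite rmorphB /= map_polyC rmorphXn /= hornerD hornerC hornerN horner_exp -hE /=.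
    by rewrite rmorphXn exprMn mulrBl mul1r [c%:~R ^+ i * _]mulrC.
  exists (D1 * D2 * N * `|c|)%N; split=> [|p m pP].
    by rewrite !muln_gt0 D10 D20 N0 absz_gt0.
  rewrite !(Euclid_dvdM _ _ pP) !negb_or -!andbA => /and4P[pD1 pD2 pN pc] pf.
  have := D1P p m pP pD1 pf; rewrite -Fp_int_eq0 // /g1 !hornerE rmorphB !rmorphXn /=.
  have c1 : (c%:~R : 'F_p) != 0 by rewrite Fp_int_eq0.
  rewrite subr_eq0 => /eqP hc; pose y : 'F_p := h.[m%:Z]%:~R / c%:~R.
  have yN : y ^+ N = 1 by rewrite expr_div_n hc divff // expf_neq0.
  have [k kP kN] := prim_order_exists N0 yN.
  have kE : k = N.
    apply/eqP; move: (dvdn_leq N0 kN); rewrite leq_eqVlt => /predU1P[->|kN1] //.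
    have := D2P p m pP pD2 pf; rewrite -Fp_int_eq0 // /g2 !hornerE rmorphB rmorphM !rmorph_prod /=.
    rewrite horner_prod rmorph_prod (@big_cat_nat _ _ _ k) ?(prim_order_gt0 kP) ?(ltnW kN1) //=.
    rewrite (big_ltn kN1) !hornerE rmorphB !rmorphXn /=.
    have -> : (h.[m%:Z]%:~R : 'F_p) ^+ k = c%:~R ^+ k.
      by have := prim_expr_order kP; rewrite expr_div_n => /divr1_eq.
    rewrite subrr mulr0 mul0r sub0r oppr_eq0 mulf_eq0 prodf_seq_eq0.
    case/orP=> [|/hasP[i _]]; first by rewrite Fp_int_eq0 // [(_ %| _)%Z](negPf pN).
    by rewrite andTb rmorphXn expf_eq0 (negPf c1) andbF.
  rewrite -kE (prim_order_dvd kP).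
  have y0 : y != 0 by apply: contra_eqN yN => /eqP->; rewrite expr0n gtn_eqF // eq_sym oner_eq0.
  rewrite -(inj_eq (mulfI y0)) mulr1 -exprS prednK ?prime_gt0 //.
  by have := expf_card y; rewrite card_Fp // => ->.
have [Ds [Ds0 DsP]] : exists D, good D (fun p => forall x, x \in s -> exists y, (y ^ N = x %[mod p])%N).
  have ex1 x : x \in s -> exists D, good D (fun p => exists y, (y ^ N = x %[mod p])%N).
    move=> xs; have [|c c0 [h hE]] := tE (N.-root x%:R).
      by rewrite in_cons; apply/orP; right; apply/mapP; exists x.
    pose g1 : {poly int} := h ^+ N - (c ^+ N * x%:Z)%:P.
    have [|D1 D10 D1P] := fP g1.
      rewrite /root /g1 rmorphB rmorphXn /= map_polyC hornerD hornerN hornerC horner_exp -hE /=.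
      by rewrite exprMn rootCK // rmorphM rmorphXn /= subrr.
    exists (D1 * `|c|)%N; split=> [|p m pP]; first by rewrite muln_gt0 D10 absz_gt0.
    rewrite (Euclid_dvdM _ _ pP) negb_or => /andP[pD pc] pf.
    have := D1P p m pP pD pf; rewrite -Fp_int_eq0 // /g1 !hornerE rmorphB rmorphM !rmorphXn /=.
    have c1 : (c%:~R : 'F_p) != 0 by rewrite Fp_int_eq0.
    rewrite subr_eq0 => /eqP hc; pose y : 'F_p := h.[m%:Z]%:~R / c%:~R.
    exists (y : nat); apply/eqP; rewrite -Fp_nat_eqmod // natrX natr_Zp.
    by rewrite expr_div_n hc mulrC mulKf ?expf_neq0.
  elim: s ex1 {sE tE} => [|x s IHs] ex1; first by exists 1%N; split.
  have [|D [D0 DP]] := IHs; first by move=> y ys; apply: ex1; rewrite in_cons ys orbT.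
  have [|D' [D'0 D'P]] := ex1 x; first exact: mem_head.
  exists (D * D')%N; split=> [|p m pP]; first by rewrite muln_gt0 D0.
  rewrite (Euclid_dvdM _ _ pP) negb_or => /andP[pD pD'] pf y.
  rewrite in_cons => /predU1P[->|]; [exact: D'P pf | exact: DP pf y].
have [|p [m [pP pD pf]]] := @prime_dvd_poly_value f (Dz * Ds * B) sf.
  by rewrite !muln_gt0 Dz0 Ds0.
move: pD; rewrite !(Euclid_dvdM _ _ pP) !negb_or -andbA => /and3P[p1 p2 p3].
by exists p; split=> //; [exact: DzP pf | exact: DsP pf].
Qed.

(** * The order Z[z] at a prime *)

Lemma poly_int_modp (p : nat) (g h : {poly int}) : prime p ->
  map_poly intr g = map_poly intr h :> {poly 'F_p} -> exists r, g = h + p%:Z *: r.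
Proof.
move=> pP e; exists (map_poly (divz^~ p%:Z) (g - h)).
apply/polyP => i; rewrite coefD coefZ coef_map_id0 ?div0z // mulrC divzK.
  by rewrite coefB addrC subrK.
rewrite -Fp_int_eq0 // coefB rmorphB subr_eq0.
by have := congr1 (fun s : {poly _} => s`_i) e; rewrite !coef_map /= => ->.
Qed.

(** Over ['F_p] the [p ^ j]-th power is additive and fixes coefficients, so it only substitutes
    ['X^(p ^ j)] for the variable. *)
Lemma poly_int_frob (p j : nat) (g : {poly int}) : prime p ->
  exists r, g ^+ (p ^ j) = (g \Po 'X^(p ^ j)) + p%:Z *: r.
Proof.
move=> pP; apply: poly_int_modp => //.
rewrite map_comp_poly rmorphXn /= map_polyXn; move: (map_poly _ _) => {}g.
have pjP : [pchar {poly 'F_p}].-nat (p ^ j)%N.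
  by rewrite pnatX pnatE // orbC (rmorph_pchar polyC) ?pchar_Fp // orbT.
have cE (c : 'F_p) : c ^+ (p ^ j) = c.
  elim: (j) => [|i IH]; first by rewrite expr1.
  by rewrite expnSr exprM IH -[X in c ^+ X](card_Fp pP) expf_card.
elim/poly_ind: g => [|g c IH]; first by rewrite comp_poly0 expr0n expn_eq0 -leqn0 leqNgt prime_gt0.
rewrite exprDn_pchar // exprMn IH -rmorphXn /= cE.
by rewrite comp_polyD comp_polyM comp_polyX comp_polyC.
Qed.

(** * The ring Z[z] inside [algC] *)

Section Adjoin.
Variable z : algC.

Definition Zadj (x : algC) := exists g : {poly int}, x = (map_poly intr g).[z].

Lemma ZadjD x y : Zadj x -> Zadj y -> Zadj (x + y).
Proof. by case=> g -> [h ->]; exists (g + h); rewrite rmorphD hornerD. Qed.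

Lemma ZadjM x y : Zadj x -> Zadj y -> Zadj (x * y).
Proof. by case=> g -> [h ->]; exists (g * h); rewrite rmorphM hornerM. Qed.

Lemma Zadj_int (a : int) : Zadj a%:~R.
Proof. by exists a%:P; rewrite map_polyC hornerC. Qed.

Lemma Zadj_nat (a : nat) : Zadj a%:R. Proof. exact: (Zadj_int a). Qed.

Lemma ZadjN x : Zadj x -> Zadj (- x).
Proof. by case=> g ->; exists (- g); rewrite rmorphN hornerN. Qed.

Lemma ZadjB x y : Zadj x -> Zadj y -> Zadj (x - y).
Proof. by move=> ? ?; apply: ZadjD => //; apply: ZadjN. Qed.

Lemma ZadjX x i : Zadj x -> Zadj (x ^+ i).
Proof.
move=> zx; elim: i => [|i IH]; first exact: (Zadj_int 1).
by rewrite exprS; apply: ZadjM.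
Qed.

Lemma Zadj_id : Zadj z. Proof. by exists 'X; rewrite map_polyX hornerX. Qed.

Lemma Zadj_sum (I : Type) (r : seq I) (P : pred I) F :
  (forall i, P i -> Zadj (F i)) -> Zadj (\sum_(i <- r | P i) F i).
Proof. by apply: big_ind; [exact: (Zadj_int 0) | exact: ZadjD]. Qed.

Lemma Zadj_prod (I : Type) (r : seq I) (P : pred I) F :
  (forall i, P i -> Zadj (F i)) -> Zadj (\prod_(i <- r | P i) F i).
Proof. by apply: big_ind; [exact: (Zadj_int 1) | exact: ZadjM]. Qed.

Lemma Zadj_Aint x : z \in Aint -> Zadj x -> x \in Aint.
Proof.
move=> zA [g ->]; elim/poly_ind: g => [|g c IH]; first by rewrite rmorph0 horner0 rpred0.
rewrite rmorphD rmorphM /= map_polyX map_polyC hornerD hornerM hornerX hornerC.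
by rewrite rpredD ?rpredM //= Aint_int.
Qed.

(** The quotient stays in Z[z], which the saturation argument needs; [dvdA_hornerB] controls it only
    as an algebraic integer. *)
Lemma Zadj_hornerB (g : {poly int}) a b : Zadj a -> Zadj b ->
  exists2 c, Zadj c & (map_poly intr g).[a] - (map_poly intr g).[b] = (a - b) * c.
Proof.
move=> za zb; elim/poly_ind: g => [|g e [c zc cE]].
  by exists 0; [exact: (Zadj_int 0) | rewrite rmorph0 !horner0 subrr mulr0].
have zgb : Zadj (map_poly intr g).[b].
  by case: zb => h ->; exists (g \Po h); rewrite map_comp_poly horner_comp.
exists (c * a + (map_poly intr g).[b]).
  by apply: ZadjD => //; apply: ZadjM.
rewrite rmorphD rmorphM /= map_polyX map_polyC !hornerD !hornerM !hornerX !hornerC.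
move: cE; set A := _.[a]; set B := _.[b]; move=> cE.
have -> : A = (a - b) * c + B by rewrite -cE subrK.
ring.
Qed.

End Adjoin.

Lemma dvdA_M (e x y : algC) : (e %| x)%A -> y \in Aint -> (e %| x * y)%A.
Proof. by rewrite -!eqAmod0 => ex yA; rewrite -(mul0r y) eqAmodMr. Qed.

Lemma dvdA_quot (e x : algC) : e != 0 -> (e %| x)%A = (x / e \in Aint).
Proof. by move=> e0; rewrite unfold_in (negPf e0). Qed.

Lemma dvdA_hornerB (e a b : algC) (g : {poly int}) : a \in Aint -> b \in Aint ->
  (e %| a - b)%A -> (e %| (map_poly intr g).[a] - (map_poly intr g).[b])%A.
Proof.
move=> aA bA ab; elim/poly_ind: g => [|g c IH]; first by rewrite rmorph0 !horner0 subrr rpred0.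
rewrite rmorphD rmorphM /= map_polyX map_polyC !hornerD !hornerM !hornerX !hornerC.
set x := _.[a] in IH *; set y := _.[b] in IH *.
have -> : x * a + c%:~R - (y * b + c%:~R) = (x - y) * a + (a - b) * y by ring.
rewrite rpredD ?dvdA_M //; apply: (@Zadj_Aint b) => //; by exists g.
Qed.

(** * Maximality of Z[z] at [q], given a local generator [pi], and the Frobenius congruence *)

Section LocalGenerator.
Variables (z : algC) (q k f : nat) (pi u v : algC).
Hypotheses (zA : z \in Aint) (qP : prime q) (f0 : (0 < f)%N).
Hypotheses (pi0 : pi != 0) (zpi : Zadj z pi) (zu : Zadj z u) (zv : Zadj z v).
Hypotheses (uv : u * v = 1) (qE : q%:R = pi ^+ k * u).
Hypothesis zfrob : exists2 w, Zadj z w & z ^+ (q ^ f) - z = pi * w.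

Let Q := (q ^ f)%N.

Lemma frob_exponent_gt1 : (1 < Q)%N.
Proof. by rewrite -(expn0 q) ltn_exp2l // prime_gt1. Qed.

Lemma pi_is_Aint : pi \in Aint. Proof. exact: Zadj_Aint zpi. Qed.

(** For [k = 0] the prime [q] would be a unit, making the rational number [1 / q] an algebraic
    integer. *)
Lemma pi_exponent_gt0 : (0 < k)%N.
Proof.
rewrite lt0n; apply/eqP => k0; have : (q%:R^-1 : algC) \in Num.int.
  apply: Cint_rat_Aint; first by rewrite rpredV rpred_nat.
  rewrite qE k0 mul1r (_ : u^-1 = v); first exact: Zadj_Aint zv.
  by rewrite -[LHS]mulr1 -uv mulKf //; apply: contra_eq_neq uv => ->; rewrite mul0r eq_sym oner_eq0.
move/intrP=> [a aE]; have : (a * q%:Z)%:~R = 1%:~R :> algC.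
  by rewrite intrM -aE mulVf // pnatr_eq0 -lt0n prime_gt0.
move/intr_inj => aq; have := dvdz_mull a (dvdzz q%:Z); rewrite aq.
by rewrite dvdz1 /= => /eqP q1; have := qP; rewrite q1.
Qed.

Lemma pi_dvd_q : exists2 w, Zadj z w & q%:R = pi * w.
Proof.
exists (pi ^+ k.-1 * u); first by apply: ZadjM => //; apply: ZadjX.
by rewrite mulrA -exprS prednK ?pi_exponent_gt0.
Qed.

Lemma pi_dvdA_q : (pi %| q%:R)%A.
Proof.
have [w zw ->] := pi_dvd_q; rewrite dvdA_quot // mulrC mulKf //.
exact: Zadj_Aint zw.
Qed.

(** For [x = g(z)], the power [x ^+ Q] is [g(z ^+ Q)] modulo [q]; then [z ^+ Q] is [z] modulo [pi],
    and [pi] divides [q] in Z[z]. *)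
Lemma Zadj_frob x : Zadj z x -> exists2 w, Zadj z w & x ^+ Q - x = pi * w.
Proof.
case=> g ->; have [r rE] := @poly_int_frob q f g qP.
have := congr1 (fun h => (map_poly intr h).[z]) rE.
rewrite rmorphXn rmorphD /= map_comp_poly map_polyXn map_polyZ /= horner_exp hornerD.
rewrite horner_comp hornerXn hornerZ => ->.
have [|c zc cE] := @Zadj_hornerB z g (z ^+ Q) z _ (Zadj_id z); first exact: ZadjX (Zadj_id z).
have [w zw wE] := zfrob; have [t zt tE] := pi_dvd_q.
exists (w * c + t * (map_poly intr r).[z]).
  by apply: ZadjD; apply: ZadjM => //; exists r.
by rewrite addrAC cE wE -[q%:~R]/(q%:R) tE mulrDr !mulrA.
Qed.

Lemma Zadj_frob_iter x i : Zadj z x -> exists2 w, Zadj z w & x ^+ (Q ^ i) - x = pi * w.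
Proof.
move=> zx; elim: i => [|i [w zw wE]].
  by exists 0; [exact: (Zadj_int z 0) | rewrite expr1 subrr mulr0].
have [t zt tE] := Zadj_frob (ZadjX (Q ^ i) zx).
exists (t + w); first exact: ZadjD.
by rewrite mulrDr -tE -wE -exprM -expnSr addrA subrK.
Qed.

(* An equation of integral dependence of [x] puts a power of [pi * x] in
   [pi Z[z]]; the Frobenius congruence brings that down to [pi * x] itself. *)
Lemma Zadj_pi_saturated x : Zadj z (pi * x) -> x \in Aint -> Zadj z x.
Proof.
move=> zy xA; set y := pi * x in zy.
have /floorpP[g gE] : minCpoly x \is a polyOver Num.int by [].
pose r := (size (minCpoly x)).-1.
have r0 : (0 < r)%N by rewrite /r -subn1 subn_gt0 size_minCpoly.
have sr : size (minCpoly x) = r.+1 by rewrite prednK // (ltn_trans _ (size_minCpoly x)).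
have [c zc cE] : exists2 c, Zadj z c & y ^+ r = pi * c.
  have := root_minCpoly x; rewrite /root horner_coef sr big_ord_recr /=.
  have /monicP := minCpoly_monic x; rewrite lead_coefE sr /= => ->; rewrite mul1r addrC addr_eq0.
  move/eqP => xr; exists (- \sum_(i < r) (minCpoly x)`_i * pi ^+ (r - i.+1) * y ^+ i).
    apply/ZadjN/Zadj_sum => i _; apply: ZadjM; last exact: ZadjX.
    by apply: ZadjM; [rewrite gE coef_map; apply: Zadj_int | apply: ZadjX].
  rewrite exprMn xr !mulrN; congr (- _); rewrite !mulr_sumr; apply: eq_bigr => i _.
  have -> : pi ^+ r = pi * pi ^+ (r - i.+1) * pi ^+ i.
    by rewrite -exprS -exprD; congr (_ ^+ _); have := ltn_ord i; lia.
  by rewrite /y exprMn; ring.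
(* The iterate [Q ^ r] is large enough for [y ^+ (Q ^ r)] to absorb [y ^+ r = pi * c]. *)
have Qr : (r <= Q ^ r)%N by apply/ltnW/ltn_expl/frob_exponent_gt1.
have [w zw wE] := Zadj_frob_iter r zy.
suff -> : x = c * y ^+ (Q ^ r - r) - w.
  by apply: ZadjB => //; apply: ZadjM => //; apply: ZadjX.
apply: (mulfI pi0); rewrite mulrBr mulrA -cE -exprD subnKC // -wE.
by rewrite opprB addrC subrK.
Qed.

Lemma Zadj_q_saturated x c : Zadj z (q%:R ^+ c * x) -> x \in Aint -> Zadj z x.
Proof.
have step i y : Zadj z (pi ^+ i * y) -> y \in Aint -> Zadj z y.
  elim: i => [|i IH] zy yA; first by rewrite mul1r in zy.
  apply: IH => //; apply: Zadj_pi_saturated; first by rewrite mulrA -exprS.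
  by rewrite rpredM ?rpredX ?pi_is_Aint.
have uA : u \in Aint by exact: Zadj_Aint zu.
elim: c x => [|c IH] x zx xA; first by rewrite mul1r in zx.
have := zx; rewrite exprSr -mulrA => /IH -/(_ _).
have qxA : q%:R * x \in Aint by rewrite rpredM ?rpred_nat.
move/(_ qxA); rewrite qE -mulrA => /step -/(_ _).
have uxA : u * x \in Aint by rewrite rpredM.
by move/(_ uxA) => /(ZadjM zv); rewrite mulrA [v * u]mulrC uv mul1r.
Qed.

Definition Qadj (x : algC) := exists g : {poly rat}, x = (map_poly ratr g).[z].

(** This is maximality at [q]: saturation removes the [q]-part of any denominator of [x]. *)
Lemma Qadj_denominator x : Qadj x -> x \in Aint ->
  exists2 D : nat, coprime D q & Zadj z (D%:R * x).
Proof.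
move=> [g xE] xA; have [h [a a0 gE]] := rat_poly_scale g.
have zax : Zadj z (a%:~R * x).
  exists h; rewrite xE gE map_polyZ hornerZ fmorphV /= ratr_int mulVKf ?intr_eq0 //.
  by congr horner; rewrite -map_poly_comp; apply: eq_map_poly => b; rewrite /= ratr_int.
have {zax} : Zadj z (`|a|%N%:R * x).
  have [s ->] : exists s : int, `|a|%N%:R = s%:~R * a%:~R :> algC.
    by exists (Num.sg a); rewrite -intrM -normrEsg -abszE.
  by rewrite -mulrA; apply: ZadjM => //; apply: Zadj_int.
have a1 : (0 < `|a|)%N by rewrite absz_gt0.
have [D qD aE] := pfactor_coprime qP a1; rewrite {1}aE => zD.
exists D; first by rewrite coprime_sym.
apply: (@Zadj_q_saturated _ (logn q `|a|)); last by rewrite rpredM ?rpred_nat.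
by rewrite mulrA -natrX -natrM mulnC.
Qed.

(** With [D * x = g(z)], both [g(tau z)] and [(D * x) ^+ (q ^ j)] are congruent to [g(z ^+ (q ^ j))]
    modulo [pi]. By Fermat [D ^+ (q ^ j)] is [D] modulo [q], and Bezout cancels [D], which is prime
    to [q]. *)
Lemma Qadj_frob (tau : {rmorphism algC -> algC}) (j : nat) x :
  Qadj x -> x \in Aint -> (pi %| tau z - z ^+ (q ^ j))%A -> (pi %| tau x - x ^+ (q ^ j))%A.
Proof.
move=> zx xA tz; have [D Dq [g gE]] := Qadj_denominator zx xA.
have DD : (pi %| D%:R ^+ (q ^ j) - D%:R)%A.
  have : (D ^ (q ^ j) == D %[mod q])%N.
    rewrite -Fp_nat_eqmod // natrX; elim: (j) => [|i IH]; first by rewrite expr1.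
    rewrite expnSr exprM (eqP IH); have := expf_card (D%:R : 'F_q).
    by rewrite card_Fp // => ->.
  rewrite -eqAmod_nat => DqA.
  have {DqA} : (q%:R %| D%:R ^+ (q ^ j) - D%:R)%A by rewrite -natrX.
  rewrite dvdA_quot ?pnatr_eq0 -?lt0n ?prime_gt0 // => DA.
  set c := _ - _ in DA *; have -> : c = q%:R * (c / q%:R).
    by rewrite mulrC divfK // pnatr_eq0 -lt0n prime_gt0.
  by rewrite dvdA_M ?pi_dvdA_q.
have tA : tau x \in Aint by rewrite Aint_aut.
have DB : (pi %| D%:R * (tau x - x ^+ (q ^ j)))%A.
  have e1 : D%:R * tau x = (map_poly intr g).[tau z].
    rewrite -(rmorph_nat tau) -rmorphM /= gE -horner_map -map_poly_comp.
    by congr horner; apply: eq_map_poly => b; rewrite /= rmorph_int.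
  have [r /(congr1 (fun h => (map_poly intr h).[z]))] := @poly_int_frob q j g qP.
  rewrite rmorphXn rmorphD /= map_comp_poly map_polyXn map_polyZ /= horner_exp hornerD.
  rewrite horner_comp hornerXn hornerZ -gE exprMn => e2.
  have -> : D%:R * (tau x - x ^+ (q ^ j)) =
      ((map_poly intr g).[tau z] - (map_poly intr g).[z ^+ (q ^ j)])
      - q%:R * (map_poly intr r).[z] + (D%:R ^+ (q ^ j) - D%:R) * x ^+ (q ^ j).
    by rewrite mulrBr e1 mulrBl e2 -[q%:~R]/(q%:R); ring.
  apply: rpredD; last by rewrite dvdA_M ?rpredX.
  apply: rpredB; last by rewrite dvdA_M ?pi_dvdA_q // (@Zadj_Aint z) //; exists r.
  by apply: dvdA_hornerB; rewrite ?Aint_aut ?rpredX.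
have /coprimezP[[a b] /= ab] : coprimez D%:Z q%:Z by [].
have abC : a%:~R * D%:R + b%:~R * q%:R = 1 :> algC.
  by have := congr1 (intr : int -> algC) ab; rewrite rmorphD !rmorphM.
move: DB; set Y := tau x - _ => DB.
have -> : Y = D%:R * Y * a%:~R + q%:R * (b%:~R * Y).
  by transitivity ((a%:~R * D%:R + b%:~R * q%:R) * Y); [rewrite abC mul1r | ring].
apply: rpredD; apply: dvdA_M; rewrite ?pi_dvdA_q ?Aint_int //.
by rewrite rpredM ?rpredB ?rpredX ?Aint_int.
Qed.

End LocalGenerator.

(** * Prime ideals *)

Section AintPrime.

(** A prime ideal in the ring of all algebraic integers, so that one [A] restricts to compatible
    primes in [M] and [L]. *)
Definition Aint_prime (A : algC -> Prop) :=
  [/\ forall x, A x -> x \in Aint,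
      forall x y, A x -> A y -> A (x + y),
      forall a x, a \in Aint -> A x -> A (a * x),
      ~ A 1 &
      forall x y, x \in Aint -> y \in Aint -> A (x * y) -> A x \/ A y].

(** Zorn's lemma gives an ideal maximal among the proper ones containing [p], and maximal ideals are
    prime. *)
Lemma Aint_prime_exists (p : nat) : prime p -> exists A, Aint_prime A /\ A p%:R.
Proof.
move=> pP; pose I (X : algC -> Prop) := [/\ forall x, X x -> x \in Aint,
  forall x y, X x -> X y -> X (x + y), forall a x, a \in Aint -> X x -> X (a * x),
  ~ X 1 & X p%:R].
(* The empty chain has empty union, so the ideal conditions are imposed on nonempty sets only; the
   multiples of [p] show later that [A] is nonempty. *)
have [F FI Ft|A [AI Amax]] := @classical_sets.Zorn_bigcup algC (fun X => (exists x, X x) -> I X).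
  case=> x0 [X0 FX0 X0x]; have /(_ (ex_intro _ _ X0x)) I0 := FI _ FX0.
  split.
  - by move=> x [X FX Xx]; have [H _ _ _ _] := FI X FX (ex_intro _ _ Xx); apply: H.
  - move=> x y [X FX Xx] [Y FY Yy]; have [XY|YX] := Ft X Y FX FY.
      by exists Y => //; have [_ H _ _ _] := FI Y FY (ex_intro _ _ Yy); apply: H => //; apply: XY.
    by exists X => //; have [_ H _ _ _] := FI X FX (ex_intro _ _ Xx); apply: H => //; apply: YX.
  - by move=> a x aA [X FX Xx]; exists X => //; have [_ _ H _ _] := FI X FX (ex_intro _ _ Xx); apply: H.
  - by case=> X FX X1; have [_ _ _ H _] := FI X FX (ex_intro _ _ X1).
  - by exists X0 => //; case: I0.
have maxE (B : algC -> Prop) : (forall x, A x -> B x) -> I B -> forall x, B x -> A x.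
  move=> AB IB x Bx; apply: boolp.contrapT => nAx; apply: (Amax B) => //.
  by split=> // BA; apply/nAx/BA.
have p0 : (p%:R : algC) != 0 by rewrite pnatr_eq0 -lt0n prime_gt0.
have Ip : I (fun x => (p%:R %| x)%A).
  split=> [x|x y|a x aA|/idP|].
  - by rewrite dvdA_quot // => H; rewrite -(divfK p0 x) rpredM ?rpred_nat.
  - exact: rpredD.
  - by move=> ?; rewrite mulrC dvdA_M.
  - by apply/negP; have := eqAmod0_nat p 1; rewrite eqAmod0 => ->; rewrite dvdn1 gtn_eqF ?prime_gt1.
  - by rewrite dvdA_quot // divff // rpred1.
have A0 : exists x, A x.
  apply: boolp.contrapT => nA; have Av x : ~ A x by move=> Ax; apply: nA; exists x.
  by apply: (Av p%:R); apply: (maxE _ _ Ip) => [x /Av //|]; case: Ip.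
have [AA AD AM A1 Ap] := AI A0; exists A; split=> //; split=> // x y xA yA Axy.
apply: boolp.contrapT => /boolp.not_orP[nAx nAy].
have A_0 : A 0 by rewrite -(mul0r p%:R); apply: AM.
(* The ideal generated by [A] and [x]: if it is proper, maximality puts [x] in [A]; if it contains
   [1 = a + b * x], multiplying by [y] puts [y] in [A]. *)
pose B w := exists a b, [/\ A a, b \in Aint & w = a + b * x].
have IB : I B; last first.
  apply: nAx; apply: (maxE B) => //.
    by move=> a Aa; exists a, 0; rewrite mul0r addr0; split; rewrite ?rpred0.
  by exists 0, 1; rewrite add0r mul1r; split; rewrite ?rpred1.
split.
- by move=> _ [a [b [Aa bA ->]]]; apply: rpredD; [exact: AA | rewrite rpredM].
- move=> _ _ [a [b [Aa bA ->]]] [c [d [Ac dA ->]]]; exists (a + c), (b + d).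
  by split; [exact: AD | rewrite rpredD | ring].
- move=> e _ eA [a [b [Aa bA ->]]]; exists (e * a), (e * b).
  by split; [exact: AM | rewrite rpredM | ring].
- case=> a [b [Aa bA e]]; apply: nAy.
  have -> : y = y * a + b * (x * y) by rewrite -[LHS]mul1r e; ring.
  by apply: AD; apply: AM.
- by exists p%:R, 0; rewrite mul0r addr0; split; rewrite ?rpred0.
Qed.

Variable A : algC -> Prop.
Hypothesis AP : Aint_prime A.

Lemma Aint_prime0 x : A x -> A 0.
Proof. by have [_ _ AM _ _] := AP; move=> Ax; rewrite -(mul0r x); apply: AM. Qed.

Lemma Aint_primeB x y : A x -> A y -> A (x - y).
Proof.
have [_ AD AM _ _] := AP; move=> Ax Ay; apply: AD => //.
by rewrite -mulN1r; apply: AM => //; rewrite rpredN rpred1.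
Qed.

Lemma Aint_primeX x k : x \in Aint -> A (x ^+ k) -> A x.
Proof.
have [_ _ _ A1 Apr] := AP; move=> xA; elim: k => [/A1 //|k IH].
by rewrite exprS => /Apr[]//; rewrite rpredX.
Qed.

Lemma Aint_prime_sum (I : Type) (r : seq I) (P : pred I) (F : I -> algC) :
  A 0 -> (forall i, P i -> A (F i)) -> A (\sum_(i <- r | P i) F i).
Proof. by have [_ AD _ _ _] := AP; move=> A0; apply: big_ind. Qed.

Lemma Aint_prime_dvd e x : A e -> (e %| x)%A -> A x.
Proof.
have [AA AD AM A1 Apr] := AP; move=> Ae; have [e0|e0] := eqVneq e 0.
  by rewrite unfold_in e0 eqxx => /eqP->; rewrite -e0.
by rewrite dvdA_quot // => xe; rewrite -(divfK e0 x); apply: AM.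
Qed.

Lemma Aint_prime_nat (p m : nat) : prime p -> A p%:R -> A m%:R -> (p %| m)%N.
Proof.
have [AA AD AM A1 Apr] := AP; move=> pP Ap Am; apply: contra_notT A1.
rewrite -prime_coprime // => pm.
have /coprimezP[[a b] /= ab] : coprimez p%:Z m%:Z by [].
have <- : a%:~R * p%:R + b%:~R * m%:R = 1 :> algC.
  by have := congr1 (intr : int -> algC) ab; rewrite rmorphD !rmorphM.
by apply: AD; apply: AM => //; rewrite Aint_int.
Qed.

End AintPrime.

(** * Primes of an embedded number field and the bound on their ramification index *)

Section NumberFieldPrimes.
Variables (L : splittingFieldType rat) (j : {rmorphism L -> algC}).

(** The minimal polynomial of an algebraic integer is monic with integer coefficients, so
    integrality can be tested in [algC]. *)
Lemma alg_intE (x : L) : alg_int x <-> j x \in Aint.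
Proof.
have jZ (g : {poly int}) : map_poly j (map_poly intr g) = map_poly intr g.
  by rewrite -map_poly_comp; apply: eq_map_poly => a; rewrite /= rmorph_int.
split=> [[g [gM gx]]|xA].
  apply: (@root_monic_Aint (map_poly intr g)); rewrite ?monic_map //.
    by rewrite -jZ fmorph_root.
  by apply/polyOverP => i; rewrite coef_map /= intr_int.
have /floorpP[g gE] : minCpoly (j x) \is a polyOver Num.int by [].
exists g; split; last by rewrite -(fmorph_root j) jZ -gE root_minCpoly.
have := minCpoly_monic (j x); rewrite gE !monicE lead_coef_map_inj //; last exact: intr_inj.
by rewrite -[1]/(1%:~R) eqr_int.
Qed.

Lemma prime_ideal_contraction (A : algC -> Prop) (p : nat) :
  prime p -> Aint_prime A -> A p%:R ->
  prime_ideal (fun x => A (j x)) /\ lies_over (fun x : L => A (j x)) p.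
Proof.
move=> pP AP Ap; have [AA AD AM A1 Apr] := AP; do 2?split=> //.
- by move=> x Ax; apply/alg_intE/AA.
- split; first by rewrite rmorph0; apply: Aint_prime0 Ap.
  split; first by move=> x y Ax Ay; rewrite rmorphD; apply: AD.
  split; first by move=> a x /alg_intE aA Ax; rewrite rmorphM; apply: AM.
  split; first by rewrite rmorph1.
  split; first by move=> x y /alg_intE xA /alg_intE yA; rewrite rmorphM; apply: Apr.
  by exists p%:R; rewrite rmorph_nat -(fmorph_eq0 j) rmorph_nat pnatr_eq0 -lt0n prime_gt0.
- by rewrite rmorph_nat.
Qed.

Variables (q k Q : nat) (pi u v : algC).
Hypotheses (qP : prime q) (Q1 : (1 < Q)%N) (pi0 : pi != 0) (uA : u \in Aint) (vA : v \in Aint).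
Hypotheses (uv : u * v = 1) (qE : q%:R = pi ^+ k * u).
Hypothesis frob : forall x : L, j x \in Aint -> (pi %| j x ^+ Q - j x)%A.
Variable P : L -> Prop.
Hypotheses (PP : prime_ideal P) (Pq : P q%:R).

Lemma prime_idealX x i : alg_int x -> P (x ^+ i) -> P x.
Proof.
have [_ [_ [_ [_ [P1 [Ppr _]]]]]] := PP; move=> xA; elim: i => [/P1 //|i IH].
by rewrite exprS => /Ppr[]//; apply/alg_intE; rewrite rmorphXn rpredX //; apply/alg_intE.
Qed.

(** [pi] lives in [algC] and need not come from [L]; but [x ^+ k / q] is integral in [L], so
    [x ^+ k] lies in [P]. *)
Lemma pi_dvd_prime_ideal x : alg_int x -> (pi %| j x)%A -> P x.
Proof.
have [_ [_ [_ [PM _]]]] := PP; move=> xA; rewrite dvdA_quot // => xpi.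
apply: (@prime_idealX _ k) => //.
have q0 : (q%:R : L) != 0 by rewrite -(fmorph_eq0 j) rmorph_nat pnatr_eq0 -lt0n prime_gt0.
rewrite -(divfK q0 (x ^+ k)); apply: PM => //; apply/alg_intE.
rewrite rmorphM fmorphV rmorphXn rmorph_nat qE invfM.
have -> : u^-1 = v.
  by rewrite -[LHS]mulr1 -uv mulKf //; apply: contra_eq_neq uv => ->; rewrite mul0r eq_sym oner_eq0.
by rewrite mulrA -expr_div_n rpredM ?rpredX.
Qed.

(** The multiplier [s] stands for localization at [P]. For [a] in [P], the factor
    [w = 1 - a ^+ Q.-1] is outside [P], while [w * a = a - a ^+ Q] is divisible by [pi]. *)
Lemma ideal_pow_local i x : ideal_pow P i x ->
  exists s, [/\ alg_int s, ~ P s & (pi ^+ i %| j (s * x))%A].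
Proof.
have [PA [P0 [PD [PM [P1 [Ppr _]]]]]] := PP.
have int1 : alg_int (1 : L) by apply/alg_intE; rewrite rmorph1 rpred1.
have intM (a b : L) : alg_int a -> alg_int b -> alg_int (a * b).
  by move=> /alg_intE ? /alg_intE ?; apply/alg_intE; rewrite rmorphM rpredM.
have nPM a b : alg_int a -> alg_int b -> ~ P a -> ~ P b -> ~ P (a * b).
  by move=> aA bA na nb /Ppr[].
have pi_pow0 m : pi ^+ m != 0 by rewrite expf_neq0.
elim: i x => [|i IH] x /=.
  by move=> /alg_intE xA; exists 1; rewrite expr0 mul1r dvdA_quot ?oner_eq0 // divr1.
case=> r [rP ->] {x}; elim: r rP => [|[a b] r IHr] rP.
  by exists 1; rewrite big_nil mulr0 rmorph0 rpred0.
have [|s [sA sP sd]] := IHr; first by move=> ab abr; apply: rP; rewrite in_cons abr orbT.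
have /=[Pa /IH[t [tA tP td]]] := rP (a, b) (mem_head _ _).
have aA := PA _ Pa; pose w := 1 - a ^+ Q.-1.
have wA : alg_int w.
  by apply/alg_intE; rewrite rmorphB rmorph1 rmorphXn rpredB ?rpred1 ?rpredX //; apply/alg_intE.
have wP : ~ P w.
  move=> Pw; apply: P1; have -> : 1 = w + a ^+ Q.-1 by rewrite subrK.
  apply: PD => //; rewrite -(subnKC Q1) /= exprSr; apply: PM => //.
  by apply/alg_intE; rewrite rmorphXn rpredX //; apply/alg_intE.
have wd : (pi %| j (w * a))%A.
  rewrite mulrBl mul1r -exprSr prednK ?(ltnW Q1) // -rpredN -rmorphN opprB rmorphB rmorphXn.
  by apply/frob/alg_intE.
exists (s * (t * w)); split; [by apply: (intM) => //; apply: intM | by apply: (nPM) => //; [apply: intM | apply: nPM] |].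
have jA (c : L) : alg_int c -> j c \in Aint by move/alg_intE.
rewrite big_cons mulrDr rmorphD rpredD //=.
  have -> : j (s * (t * w) * (a * b)) = j (w * a) * j (t * b) * j s by rewrite !rmorphM; ring.
  rewrite dvdA_M ?jA //; move: wd td; rewrite !dvdA_quot // => wd td.
  by rewrite exprS invfM mulrACA rpredM.
have -> c : j (s * (t * w) * c) = j (s * c) * j (t * w) by rewrite !rmorphM; ring.
by rewrite dvdA_M // jA //; apply: intM.
Qed.

(** Otherwise [pi ^+ k.+1] divides [s * q] for some [s] outside [P]; cancelling [q = pi ^+ k * u]
    leaves [pi] dividing [s], which puts [s] in [P]. *)
Lemma ram_index_bound : ~ ideal_pow P k.+1 q%:R.
Proof.
move=> /ideal_pow_local[s [sA sP]]; apply/negP; apply: contra_notN sP => sd.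
apply: pi_dvd_prime_ideal => //; move: sd.
rewrite !dvdA_quot ?expf_neq0 // rmorphM rmorph_nat qE exprSr invfM => sd.
have -> : j s / pi = j s * (pi ^+ k * u) * ((pi ^+ k)^-1 / pi) * v.
  by rewrite -[LHS]mulr1 -uv; field; rewrite pi0 expf_neq0.
by rewrite rpredM.
Qed.

End NumberFieldPrimes.

(** * Subfields as number fields *)

Lemma gal_full (L : splittingFieldType rat) (s : gal_of {:L}) : s \in ('Gal({:L} / 1))%g.
Proof. by rewrite gal_kHom ?sub1v // k1AHom. Qed.

Lemma gal_of_lrmorphism (L : splittingFieldType rat) (f : {lrmorphism L -> L}) :
  {s : gal_of {:L} | forall x, s x = f x}.
Proof.
have kf : kAut 1 {:L} (linfun f).
  rewrite kAutfE; apply/kHom_monoid_morphism; split=> [|x y]; rewrite !lfunE ?rmorph1 //.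
  exact: rmorphM.
have [s _ sE] := kAut_to_gal kf; exists s => x.
by rewrite -sE ?memvf // lfunE.
Qed.

(** A primitive element [t] of [F] has all its conjugates in [F] by normality, so its minimal
    polynomial splits there. *)
Lemma normal_subfield_splitting (M : splittingFieldType rat) (F : {subfield M}) :
  galois 1 F -> SplittingField.axiom (subvs_of F).
Proof.
move=> gF; have [_ sF nF] := and3P gF.
have [t FE] : exists t, F = <<1; t>>%VS :> {vspace M}.
  by exists (separable_generator 1 F); apply: eq_adjoin_separable_generator => //; rewrite sub1v.
have tF : t \in F by rewrite FE memv_adjoin.
have /(normalField_factors (sub1v F))/(_ t tF)[r _ rE] := nF.
pose t' : subvs_of F := Subvs tF.
pose rs := [seq Subvs (memv_gal x tF) | x <- r].
pose p : {poly subvs_of F} := \prod_(y <- rs) ('X - y%:P).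
have pE : map_poly vsval p = minPoly 1 t.
  rewrite rE rmorph_prod /= big_map; apply: eq_bigr => x _.
  by rewrite map_polyXsubC.
have lift1 (c : subvs_of F) : vsval c \in 1%VS -> c \in 1%VS.
  by case/vlineP=> a ae; apply/vlineP; exists a; apply: val_inj; rewrite /= ae algid1.
have p1 : p \is a polyOver 1%VS.
  apply/polyOverP => i; apply: lift1.
  by have /polyOverP/(_ i) := minPolyOver 1 t; rewrite -pE coef_map.
exists p => //; exists rs; first exact: eqpxx.
have t'rs : t' \in rs.
  have := root_minPoly 1 t; rewrite -pE -[t]/(vsval t') fmorph_root /p.
  by rewrite root_prod_XsubC.
apply/vspaceP => x; rewrite memvf.
have Ft y : y \in F -> y \in <<1; t>>%VS by rewrite FE.
have /Ft/Fadjoin_polyP[g g1 gE] := subvsP x.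
have /polyOver_subvs[h hE] : g \is a polyOver F by apply: polyOverSv g1; apply: sub1v.
have -> : x = h.[t'].
  by apply: val_inj; rewrite /= gE hE -[t]/(vsval t') horner_map.
rewrite rpred_horner ?seqv_sub_adjoin //; apply/polyOverP => i.
have : h`_i \in 1%VS by apply: lift1; have /polyOverP/(_ i) := g1; rewrite hE coef_map.
by apply/subvP/sub1v.
Qed.

Lemma subfield_type (M : splittingFieldType rat) (F : {subfield M}) : galois 1 F ->
  exists (L : splittingFieldType rat) (j : {rmorphism L -> M}),
    forall y, y \in F <-> exists x, j x = y.
Proof.
move=> gF; pose L_ax := FieldExt_isSplittingField.Build _ (subvs_of F)
  (normal_subfield_splitting gF).
exists (HB.pack_for (splittingFieldType rat) (subvs_of F) L_ax).
exists (vsval : {rmorphism subvs_of F -> M}) => y; split=> [yF|[x <-]]; last exact: subvsP.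
by exists (vsproj F y); apply: vsprojK.
Qed.

(** [L] is the fixed field of the kernel of [Psi], made into a field of its own. [phi t] is [Psi] of
    any lift of [t] to [M]; two lifts differ by an element of the kernel. *)
Lemma quotient_number_field (M : splittingFieldType rat) (iota : {rmorphism M -> algC})
    (gT : finGroupType) (G : {group gT}) (Psi : {morphism ('Gal({:M} / 1))%g >-> gT}) :
  galois 1 {:M} -> (Psi @* ('Gal({:M} / 1)) = G)%g ->
  exists (L : splittingFieldType rat) (j : {rmorphism L -> M})
    (phi : {morphism ('Gal({:L} / 1))%g >-> gT}),
  [/\ isom ('Gal({:L} / 1))%g G phi,
      forall y, (forall s : gal_of {:M}, Psi s = 1%g -> s y = y) -> exists x, j x = y,
      forall (t : gal_of {:L}), exists2 s : gal_of {:M}, phi t = Psi s & forall x, j (t x) = s (j x) &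
      forall s : gal_of {:M}, exists2 t : gal_of {:L}, phi t = Psi s & forall x, j (t x) = s (j x)].
Proof.
move=> gM imPsi; pose F := [aspace of fixedField ('ker Psi)%G].
have gF : galois 1 F by apply: normal_fixedField_galois => //; exact: ker_normal.
have [L [j jF]] := subfield_type gF.
pose ij : {rmorphism L -> algC} := iota \o j.
(* Automorphisms pass between [L] and [M] through an extension to [algC], which restricts to each
   normal subfield. *)
have lift (t : gal_of {:L}) : {s : gal_of {:M} | forall x, j (t x) = s (j x)}.
  have [nu nuE] := extend_algC_subfield_aut ij t.
  have [f fE] := restrict_aut_to_normal_num_field iota nu.
  have [s sE] := gal_of_lrmorphism f; exists s => x; rewrite sE; apply: (fmorph_inj iota).
  by rewrite fE; apply: nuE.
have restr (s : gal_of {:M}) : {t : gal_of {:L} | forall x, j (t x) = s (j x)}.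
  have [nu nuE] := extend_algC_subfield_aut iota s.
  have [f fE] := restrict_aut_to_normal_num_field ij nu.
  have [t tE] := gal_of_lrmorphism f; exists t => x; rewrite tE; apply: (fmorph_inj iota).
  by rewrite nuE; apply: fE.
have kerPsi (s : gal_of {:M}) : (forall x, s (j x) = j x) -> Psi s = 1%g.
  move=> sj; suff : s \in ('ker Psi)%g by move/mker.
  rewrite -(gal_fixedField ('ker Psi)%G) gal_kHom ?subvf //; apply/kAHomP => y yF.
  have /jF[x <-] : y \in F by [].
  exact: sj.
have lift_uniq (s s' : gal_of {:M}) : (forall x, s (j x) = s' (j x)) -> Psi s = Psi s'.
  move=> e; apply/eqP; rewrite eq_mulgV1 -morphV ?gal_full // -morphM ?gal_full ?groupV ?gal_full //.
  apply/eqP/kerPsi => x; rewrite galM ?memvf // e -galM ?memvf // mulgV gal_id //.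
pose phi (t : gal_of {:L}) := Psi (sval (lift t)).
have phiE (t : gal_of {:L}) (s : gal_of {:M}) : (forall x, j (t x) = s (j x)) -> phi t = Psi s.
  by move=> ts; apply: lift_uniq => x; rewrite -ts /phi; case: (lift t) => s' /= <-.
have phiM : {in 'Gal({:L} / 1)%g &, {morph phi : t u / (t * u)%g}}.
  move=> t u _ _ /=; rewrite {2 3}/phi; case: (lift t) (lift u) => [s sE] [s' sE'] /=.
  rewrite -morphM ?gal_full //; apply: phiE => x; rewrite !galM ?memvf //.
  by rewrite sE' sE.
exists L, j, (Morphism phiM); split=> //.
- apply/isomP; split.
    apply/subsetP => t tk; have := mker tk; rewrite /= /phi; case: (lift t) => s sE /= s1.
    apply/set1P/eqP/gal_eqP => x _; apply: (fmorph_inj j); rewrite sE gal_id.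
    have /jF/mem_fixedFieldP[_] : exists y, j y = j x by exists x.
    apply.
    by apply/kerP; rewrite ?gal_full.
  apply/setP => g; rewrite -imPsi; apply/morphimP/morphimP => [[t _ _ ->]|[s _ _ ->]].
    by exists (sval (lift t)) => //; apply: gal_full.
  by have [t tE] := restr s; exists t; rewrite ?gal_full //= -(phiE _ _ tE).
- move=> y yH; apply/jF.
  by apply/fixedFieldP; rewrite ?memvf // => s /mker; apply: yH.
- by move=> t; exists (sval (lift t)); case: (lift t) => // s sE; apply: phiE.
- by move=> s; have [t tE] := restr s; exists t => //; apply: phiE.
Qed.

(** * Cyclotomic fields *)

Lemma cyclotomic_field (n : nat) : (0 < n)%N ->
  exists (M : splittingFieldType rat) (iota : {rmorphism M -> algC}) (w : M),
  [/\ galois 1 {:M}, n.-primitive_root w, forall x, Qadj (iota w) (iota x),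
      forall s t : gal_of {:M}, s w = t w -> s = t &
      forall k, coprime k n -> exists s : gal_of {:M}, s w = w ^+ k].
Proof.
(* Only the order [n] of [Zp n] matters: the field obtained is generated by a primitive root of
   unity of that order. *)
move=> n0; have [M gM [iota _ [w [wP wM] _]]] := group_num_field_exists (Zp n).
rewrite card_Zp // in wP; exists M, iota, w; split=> //.
- move=> x; have : x \in <<1; w>>%VS by rewrite wM memvf.
  case/Fadjoin_polyP => g /polyOverP g1 ->.
  have a_ i := sig_eqW (vlineP _ _ (g1 i)).
  exists (\poly_(i < size g) sval (a_ i)); rewrite -horner_map; congr horner.
  apply/polyP => i; rewrite !coef_map coef_poly /=; case: ltnP => [_|sz].
    by case: (a_ i) => a /= ->; rewrite alg_num_field fmorph_rat.
  by rewrite nth_default // !rmorph0.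
- move=> s t st; apply/eqP/gal_eqP => x _.
  have : x \in <<1; w>>%VS by rewrite wM memvf.
  case/Fadjoin_polyP => g g1 ->; rewrite -!horner_map /= st; congr horner.
  have s1 (u : gal_of {:M}) : map_poly u g = g.
    apply/polyP => i; rewrite coef_map /=; have /vlineP[a ->] := polyOverP g1 i.
    by rewrite linearZ /= rmorph1.
  by rewrite !s1.
- move=> k kn; have [nu nuE] := Qn_aut_exists kn.
  have [f fE] := restrict_aut_to_normal_num_field iota nu.
  have [s sE] := gal_of_lrmorphism f; exists s; rewrite sE; apply: (fmorph_inj iota).
  by rewrite fE rmorphXn nuE // -rmorphXn (prim_expr_order wP) rmorph1.
Qed.

Lemma prim_root_neq0 (F : fieldType) (m : nat) (x : F) : m.-primitive_root x -> x != 0.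
Proof.
move=> xP; apply: contra_eqN (prim_expr_order xP) => /eqP->.
by rewrite expr0n gtn_eqF ?(prim_order_gt0 xP) // eq_sym oner_eq0.
Qed.

(** A geometric sum of ratio [y / x], an [m]-th root of unity. *)
Lemma prim_root_sum (F : fieldType) (m : nat) (x y : F) :
  m.-primitive_root x -> y ^+ m = 1 ->
  \sum_(b < m) x ^- b * y ^+ b = (y == x)%:R * m%:R.
Proof.
move=> xP ym; have x0 := prim_root_neq0 xP.
have -> : \sum_(b < m) x ^- b * y ^+ b = \sum_(b < m) (y / x) ^+ b.
  by apply: eq_bigr => b _; rewrite expr_div_n mulrC.
have [->|yx] := eqVneq y x.
  by under eq_bigr do rewrite divff // expr1n; rewrite sumr_const card_ord mul1r.
have : (y / x - 1) * \sum_(b < m) (y / x) ^+ b = 0.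
  by rewrite -subrX1 expr_div_n ym (prim_expr_order xP) divr1 subrr.
move/eqP; rewrite mul0r mulf_eq0 subr_eq0 => /predU1P[e|/eqP //].
by case/eqP: yx; apply: divr1_eq.
Qed.

Lemma prim_root_exprl (F : fieldType) (a b : nat) (x : F) :
  (a * b).-primitive_root x -> b.-primitive_root (x ^+ a).
Proof.
move=> xP; have := prim_order_gt0 xP; rewrite muln_gt0 => /andP[_ b0].
by have := dvdn_prim_root xP (dvdn_mull a (dvdnn b)); rewrite mulnK.
Qed.

Lemma prim_root_exprr (F : fieldType) (a b : nat) (x : F) :
  (a * b).-primitive_root x -> a.-primitive_root (x ^+ b).
Proof. by rewrite mulnC; apply: prim_root_exprl. Qed.

(** * The local generator [1 - zeta_p] at a prime [p] dividing [n] exactly once *)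

Section RamifiedPrime.
Variables (z : algC) (p m : nat).
Hypotheses (zP : (p * m).-primitive_root z) (pP : prime p) (pm : coprime p m).

Let zp := z ^+ m.
Let pi := 1 - zp.

Lemma cofactor_gt0 : (0 < m)%N.
Proof. by have := prim_order_gt0 zP; rewrite muln_gt0 => /andP[]. Qed.

Lemma zp_prim : p.-primitive_root zp. Proof. exact: prim_root_exprr. Qed.

Lemma zm_prim : m.-primitive_root (z ^+ p). Proof. exact: prim_root_exprl. Qed.

Lemma zeta_Aint : z \in Aint. Proof. exact: Aint_prim_root zP. Qed.

Lemma Zadj_zp : Zadj z zp. Proof. by apply: ZadjX; apply: Zadj_id. Qed.

Lemma Zadj_pi : Zadj z pi.
Proof. by apply: ZadjB; [apply: (Zadj_int z 1) | exact: Zadj_zp]. Qed.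

Lemma one_sub_zpX i : 1 - zp ^+ i = pi * \sum_(l < i) zp ^+ l.
Proof. by rewrite -[LHS]opprB subrX1 -mulNr opprB. Qed.

Lemma one_sub_zpX_neq0 i : coprime i p -> 1 - zp ^+ i != 0.
Proof.
move=> ip; rewrite subr_eq0 eq_sym -(prim_order_dvd zp_prim).
by rewrite -prime_coprime // coprime_sym.
Qed.

Lemma zp_pi_neq0 : pi != 0.
Proof. by rewrite /pi -(expr1 zp) one_sub_zpX_neq0 // coprime1n. Qed.

(** [zp ^+ k] is itself a power of the primitive root [zp ^+ i], so the quotient is a geometric sum.
    Exchanging the exponents gives cyclotomic units. *)
Lemma one_sub_zpX_dvd i k : coprime i p -> Zadj z ((1 - zp ^+ k) / (1 - zp ^+ i)).
Proof.
move=> ip; have iP : p.-primitive_root (zp ^+ i) by rewrite prim_root_exp_coprime // zp_prim.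
have [|r ->] := prim_rootP iP (x := zp ^+ k).
  by rewrite exprAC (prim_expr_order zp_prim) expr1n.
rewrite -[1 - _ ^+ r]opprB subrX1 -mulNr opprB mulrC mulKf ?one_sub_zpX_neq0 //.
by apply: Zadj_sum => l _; do 2!apply: ZadjX; apply: Zadj_zp.
Qed.

Lemma one_sub_zpX_Aint i k : coprime i p -> (1 - zp ^+ k) / (1 - zp ^+ i) \in Aint.
Proof. by move=> ip; apply: (Zadj_Aint zeta_Aint); apply: one_sub_zpX_dvd. Qed.

(** [p] is the product of the [p.-1] factors [1 - zp ^+ i], each a unit multiple of [pi]. *)
Lemma p_pi_unit : exists u v,
  [/\ Zadj z u, Zadj z v, u * v = 1 & p%:R = pi ^+ p.-1 * u].
Proof.
have co i : (1 <= i < p)%N -> coprime i p.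
  move=> /andP[i1 ip]; rewrite coprime_sym prime_coprime // gtnNdvd //.
have pi1 : pi = 1 - zp ^+ 1 by [].
exists (\prod_(1 <= i < p) ((1 - zp ^+ i) / pi)), (\prod_(1 <= i < p) (pi / (1 - zp ^+ i))).
split.
- by apply: Zadj_prod => i _; rewrite pi1; apply: one_sub_zpX_dvd; rewrite coprime1n.
- rewrite big_nat; apply: Zadj_prod => i /co ip; rewrite pi1; exact: one_sub_zpX_dvd.
- rewrite -big_split big_nat big1 // => i /co ip /=.
  by rewrite mulrA divfK ?zp_pi_neq0 // divff // one_sub_zpX_neq0.
- rewrite -(prod_one_sub_prim_root zp_prim) -subn1 -prodr_const_nat -big_split.
  by apply: eq_bigr => i _ /=; rewrite mulrC divfK ?zp_pi_neq0.
Qed.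

(** [x / y] is a power of [zp], hence [1] modulo [pi]. *)
Lemma pi_dvd_eq_expp x y : y != 0 -> x ^+ p = y ^+ p ->
  exists c, x - y = pi * (- y * \sum_(l < c) zp ^+ l).
Proof.
move=> y0 xy; have [|c /(canRL (divfK y0)) xE] := prim_rootP zp_prim (x := x / y).
  by rewrite expr_div_n xy divff // expf_neq0.
by exists c; rewrite mulrCA -one_sub_zpX xE mulrBr mulr1 mulNr opprK addrC mulrC.
Qed.

Lemma pi_dvdA_eq_expp x y : y \in Aint -> y != 0 -> x ^+ p = y ^+ p -> (pi %| x - y)%A.
Proof.
move=> yA y0 /(pi_dvd_eq_expp y0)[c ->]; rewrite dvdA_quot ?zp_pi_neq0 // mulrC mulKf ?zp_pi_neq0 //.
rewrite rpredM ?rpredN // rpred_sum // => l _.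
by rewrite rpredX //; apply: (Zadj_Aint zeta_Aint); apply: Zadj_zp.
Qed.

(** By Euler [p ^ totient m] is [1] modulo [m], so the two terms have the same [p]-th power. *)
Lemma z_frob_p : exists2 w, Zadj z w & z ^+ (p ^ totient m) - z = pi * w.
Proof.
have z0 := prim_root_neq0 zP.
have [|c ->] := @pi_dvd_eq_expp (z ^+ (p ^ totient m)) z z0; last first.
  exists (- z * \sum_(l < c) zp ^+ l) => //; apply: ZadjM; first exact/ZadjN/Zadj_id.
  by apply: Zadj_sum => l _; apply/ZadjX/Zadj_zp.
rewrite exprAC; have := Euler_exp_totient pm => /eqP.
by rewrite -(eq_prim_root_expr zm_prim) expr1 => /eqP.
Qed.

(** Since [zeta_p] is [1] modulo [pi], it suffices to know [tau] on [z ^+ p], that is on the [m]-th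
    roots of unity. *)
Lemma frob_p (tau : {rmorphism algC -> algC}) (j : nat) x :
  Qadj z x -> x \in Aint -> tau z ^+ p = z ^+ (p ^ j) ^+ p -> (pi %| tau x - x ^+ (p ^ j))%A.
Proof.
move=> zx xA tz; have [u [v [zu zv uv pE]]] := p_pi_unit.
apply: (@Qadj_frob z p p.-1 (totient m) pi u v) => //.
- exact: zeta_Aint.
- by rewrite totient_gt0 cofactor_gt0.
- exact: zp_pi_neq0.
- exact: Zadj_pi.
- exact: z_frob_p.
by apply: pi_dvdA_eq_expp => //; rewrite ?rpredX ?zeta_Aint // expf_neq0 // (prim_root_neq0 zP).
Qed.

End RamifiedPrime.

(** Here [q] is its own local generator, with exponent and units equal to [1], and [tau] is the
    identity. *)
Lemma frob_unramified (z : algC) (n q : nat) x : n.-primitive_root z -> prime q -> ~~ (q %| n)%N ->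
  Qadj z x -> x \in Aint -> (q%:R %| x ^+ (q ^ totient n) - x)%A.
Proof.
move=> zP qP qn zx xA; have qn1 : coprime q n by rewrite prime_coprime.
have zQ : z ^+ (q ^ totient n) = z.
  have := Euler_exp_totient qn1 => /eqP.
  by rewrite -(eq_prim_root_expr zP) expr1 => /eqP.
have q0 : q%:R != 0 :> algC by rewrite pnatr_eq0 -lt0n prime_gt0.
rewrite -rpredN opprB -[X in X - _]/((idfun : {rmorphism algC -> algC}) x).
apply: (@Qadj_frob z q 1 (totient n) q%:R 1 1) => //.
- exact: Aint_prim_root zP.
- by rewrite totient_gt0 (prim_order_gt0 zP).
- exact: Zadj_nat.
- exact: (Zadj_int z 1).
- exact: (Zadj_int z 1).
- by rewrite mulr1.
- by rewrite mulr1 expr1.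
- by exists 0; [exact: (Zadj_int z 0) | rewrite zQ subrr mulr0].
- by rewrite /= zQ subrr rpred0.
Qed.

(** * Subfields of a cyclotomic field *)

Lemma ideal_pow_decr (L : splittingFieldType rat) (P : L -> Prop) (i : nat) x :
  prime_ideal P -> ideal_pow P i.+1 x -> ideal_pow P i x.
Proof.
case=> PA [P0 [PD [PM _]]]; elim: i x => [|i IH] x.
  case=> r [rP ->]; apply: PA; rewrite big_seq; apply: big_ind => // ab /rP[Pa Ab].
  by rewrite mulrC; apply: PM.
case=> r [rP ->]; exists r; split=> // ab /rP[Pa Pb]; split=> //; exact: IH.
Qed.

Lemma ideal_pow1 (L : splittingFieldType rat) (P : L -> Prop) x :
  alg_int (1 : L) -> P x -> ideal_pow P 1 x.
Proof.
move=> int1 Px; exists [:: (x, 1)]; rewrite big_seq1 mulr1; split=> // ab.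
by rewrite inE => /eqP->.
Qed.

Section SubCyclotomic.
Variables (M L : splittingFieldType rat) (iota : {rmorphism M -> algC}) (j : {rmorphism L -> M}).
Variables (w : M) (n : nat).
Hypotheses (wP : n.-primitive_root w) (wQ : forall x, Qadj (iota w) (iota x)).

Let J : {rmorphism L -> algC} := iota \o j.
Let z := iota w.

Lemma zeta_prim : n.-primitive_root z.
Proof. by rewrite /z fmorph_primitive_root. Qed.

Lemma L_int1 : alg_int (1 : L).
Proof. by apply/(alg_intE J); rewrite rmorph1 rpred1. Qed.

Lemma unramified_bound (q : nat) (P : L -> Prop) :
  prime q -> ~~ (q %| n)%N -> prime_ideal P -> P q%:R -> ~ ideal_pow P 2 q%:R.
Proof.
move=> qP qn PP Pq; have q0 : q%:R != 0 :> algC by rewrite pnatr_eq0 -lt0n prime_gt0.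
apply: (@ram_index_bound L J q 1 (q ^ totient n) q%:R 1 1); rewrite ?rpred1 ?mulr1 //.
  by rewrite -(expn0 q) ltn_exp2l ?prime_gt1 // totient_gt0 (prim_order_gt0 wP).
by move=> x xA; apply: (frob_unramified zeta_prim) => //; apply: wQ.
Qed.

(** * Inertia and decomposition at a prime [p] dividing [n] *)

Section AtPrime.
Variables (p m : nat).
Hypotheses (nE : n = (p * m)%N) (pP : prime p) (pm : coprime p m).

Let zpm : (p * m).-primitive_root z. Proof. by rewrite -nE zeta_prim. Qed.
Let pi := 1 - z ^+ m.
Let Q := (p ^ totient m)%N.

Lemma frob_Q_gt1 : (1 < Q)%N.
Proof. by rewrite -(expn0 p) ltn_exp2l ?prime_gt1 // totient_gt0 (cofactor_gt0 zpm). Qed.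

Lemma frob_Q (x : L) : J x \in Aint -> (pi %| J x ^+ Q - J x)%A.
Proof.
move=> xA; rewrite -rpredN opprB -[X in X - _]/((idfun : {rmorphism algC -> algC}) (J x)).
apply: (frob_p zpm) => //=.
rewrite exprAC; have := Euler_exp_totient pm => /eqP.
by rewrite -(eq_prim_root_expr (zm_prim zpm)) expr1 => /eqP ->.
Qed.

Lemma ramified_bound (P : L -> Prop) : prime_ideal P -> P p%:R -> ~ ideal_pow P p p%:R.
Proof.
move=> PP Pp; have [u [v [zu zv uv pE]]] := p_pi_unit zpm pP.
have zA := zeta_Aint zpm.
rewrite -{1}(prednK (prime_gt0 pP)).
apply: (@ram_index_bound L J p p.-1 Q pi u v) => //.
- exact: frob_Q_gt1.
- exact: (zp_pi_neq0 zpm pP).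
- exact: (Zadj_Aint zA zv).
- exact: frob_Q.
Qed.

Variable A : algC -> Prop.
Hypotheses (AP : Aint_prime A) (Ap : A p%:R).
Let P (x : L) := A (J x).

Let PP : prime_ideal P. Proof. by have [] := prime_ideal_contraction J pP AP Ap. Qed.

Lemma pi_in_A : A pi.
Proof.
have [u [v [zu zv uv pE]]] := p_pi_unit zpm pP; have zA := zeta_Aint zpm.
apply: (Aint_primeX AP (k := p.-1)); first by apply: (Zadj_Aint zA); apply: Zadj_pi.
have [_ _ AM _ _] := AP; rewrite -[pi ^+ _]mulr1 -uv mulrA -pE mulrC.
by apply: AM => //; apply: (Zadj_Aint zA zv).
Qed.

Variables (gT : finGroupType) (T : {group gT}).
Variables (Psi : {morphism ('Gal({:M} / 1))%g >-> gT}) (phi : {morphism ('Gal({:L} / 1))%g >-> gT}).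
Hypothesis gal_inj : forall s t : gal_of {:M}, s w = t w -> s = t.
Hypothesis gal_ex : forall k, coprime k n -> exists s : gal_of {:M}, s w = w ^+ k.
Hypothesis phi_inj : ('injm phi)%g.
Hypothesis L_fixed :
  forall y, (forall s : gal_of {:M}, Psi s = 1%g -> s y = y) -> exists x, j x = y.
Hypothesis L_lift : forall (t : gal_of {:L}),
  exists2 s : gal_of {:M}, phi t = Psi s & forall x, j (t x) = s (j x).
Hypothesis L_restr : forall s : gal_of {:M},
  exists2 t : gal_of {:L}, phi t = Psi s & forall x, j (t x) = s (j x).

Let wm := w ^+ p.
Let wp := w ^+ m.

Lemma wp_prim : p.-primitive_root wp. Proof. by apply: prim_root_exprr; rewrite -nE. Qed.

Lemma wm_prim : m.-primitive_root wm. Proof. by apply: prim_root_exprl; rewrite -nE. Qed.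

Hypothesis inertia_sub : forall s : gal_of {:M}, s wm = wm -> Psi s \in T.
Hypothesis inertia_onto : forall t, t \in T -> exists2 s : gal_of {:M}, s wm = wm & Psi s = t.
Hypothesis frob_trivial :
  forall s : gal_of {:M}, s (w ^+ m) = w ^+ m -> s wm = wm ^+ p -> Psi s = 1%g.

Let jL (s : gal_of {:M}) (t : gal_of {:L}) : phi t = Psi s -> forall x, j (t x) = s (j x).
Proof.
by move=> e; have [t' e' t'E] := L_restr s; rewrite (_ : t = t') //;
   apply: (injmP phi_inj); rewrite ?gal_full // e.
Qed.

Let algC_ext (s : gal_of {:M}) : exists nu : {rmorphism algC -> algC}, forall x, iota (s x) = nu (iota x).
Proof. by have [nu nuE] := extend_algC_subfield_aut iota s; exists nu. Qed.

(** Lift [t] to an [s] fixing the [m]-th roots of unity; the congruence with exponent [p ^ 0] says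
    that [s] is trivial modulo [pi]. *)
Lemma inertia_of_T (t : gal_of {:L}) : phi t \in T -> in_inertia P t.
Proof.
case/inertia_onto=> s swm /esym/jL sE; have [nu nuE] := algC_ext s.
have dA x : alg_int x -> P (t x - x).
  move/(alg_intE J) => xA; rewrite /P rmorphB; apply: (Aint_prime_dvd AP pi_in_A).
  have := @frob_p z p m zpm pP pm nu 0 (J x) (wQ _) xA; rewrite expn0 !expr1.
  rewrite /J /= sE nuE; apply.
  rewrite /z -nuE -!(rmorphXn iota) -(rmorphXn s); congr (iota _); exact: swm.
have [PA [_ [PD [PM _]]]] := PP.
have tA x : alg_int x <-> alg_int (t x).
  by rewrite !(alg_intE J) /J /= sE nuE Aint_aut.
split=> // x; split=> Px; last first.
  have xA : alg_int x by apply/tA/PA.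
  by have := Aint_primeB AP Px (dA x xA); rewrite -rmorphB opprB addrC subrK.
by have := PD _ _ (dA x (PA _ Px)) Px; rewrite subrK.
Qed.

(* The Frobenius at [p] is trivial on [L], so every residue satisfies
   [x ^+ p = x]. *)
Lemma residue_int (x : L) : alg_int x -> exists a : nat, P (x - a%:R).
Proof.
move=> xint; have xA : J x \in Aint by apply/(alg_intE J).
have [AA AD AM A1 Apr] := AP.
(* The automorphism of exponent [k] fixes [zeta_p] and acts as Frobenius on the [m]-th roots of
   unity, so [frob_trivial] makes it trivial on [L]. *)
pose k := chinese p m 1 p.
have kp : (k = 1 %[mod p])%N by apply: chinese_modl.
have km : (k = p %[mod m])%N by apply: chinese_modr.
have kn : coprime k n.
  by rewrite nE coprimeMr -coprime_modl kp coprime_modl coprime1n -coprime_modl km coprime_modl pm.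
have [s sw] := gal_ex kn; have [nu nuE] := algC_ext s.
have ps1 : Psi s = 1%g.
  apply: frob_trivial; rewrite rmorphXn /= sw exprAC.

    have -> : w ^+ m ^+ k = w ^+ m ^+ 1.
      apply/eqP; rewrite (@eq_prim_root_expr _ p) ?kp ?eqxx //.
      exact: wp_prim.
    by rewrite expr1.
  apply/eqP; rewrite (@eq_prim_root_expr _ m) ?km ?eqxx //.
  exact: wm_prim.
have sL y : s (j y) = j y.
  by rewrite -(@jL s 1%g) ?gal_id // morph1.
have : A (J x - J x ^+ p).
  apply: (Aint_prime_dvd AP pi_in_A).
  have := @frob_p z p m zpm pP pm nu 1 (J x) (wQ _) xA; rewrite expn1.
  rewrite /J /= -[nu (iota (j x))]nuE sL => H; apply: H.
  rewrite -[z]/(iota w) -nuE sw -!rmorphXn; congr (iota _).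
  rewrite [LHS]exprAC; apply/eqP; rewrite (@eq_prim_root_expr _ m) ?km ?eqxx //.
  exact: wm_prim.
(* The product of all ['X - a] is ['X^p - 'X] modulo [p], so [A] contains the product of the
   [J x - a], hence one factor. *)
have [r] : exists r : {poly int}, \prod_(0 <= a < p) ('X - a%:Z%:P) = ('X^p - 'X) + p%:Z *: r.
  apply: poly_int_modp => //; rewrite rmorphB rmorph_prod /= map_polyXn map_polyX.
  transitivity (\prod_(0 <= a < p) ('X - a%:R%:P) : {poly 'F_p}).
    by apply: eq_bigr => a _; rewrite rmorphB /= map_polyX map_polyC.
  transitivity ('X^#|'F_p| - 'X : {poly 'F_p}); last by rewrite card_Fp.
  rewrite finField_genPoly -[X in \prod_(0 <= a < X) _](Fp_cast pP) big_mkord; apply: eq_bigr => a _.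
  by rewrite natr_Zp.
move/(congr1 (fun h => (map_poly intr h).[J x])) => e dx.
have {e dx} : A (\prod_(0 <= a < p) (J x - a%:R)).
  move: e; rewrite rmorph_prod horner_prod /= rmorphD rmorphB /= map_polyXn map_polyX map_polyZ /=.
  rewrite !hornerE => e.
  have -> : \prod_(0 <= a < p) (J x - a%:R) = - (J x - J x ^+ p) + p%:R * (map_poly intr r).[J x].
    rewrite opprB -[p%:R]/(p%:~R) -e; apply: eq_bigr => a _.
    by rewrite rmorphB /= map_polyX map_polyC !hornerE.
  apply: AD; first by rewrite -mulN1r; apply: AM; rewrite ?rpredN ?rpred1.
  by rewrite mulrC; apply: AM => //; apply: (Zadj_Aint xA); exists r.
elim: (index_iota 0 p) => [|a l IH]; first by rewrite big_nil => /A1.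
rewrite big_cons => /Apr[||Aa|/IH //].
- by rewrite rpredB ?rpred_nat.
- by apply: rpred_prod => b _; rewrite rpredB ?rpred_nat.
by exists a; rewrite /P rmorphB rmorph_nat.
Qed.

(** Each [x] is congruent to a natural number, which [t] fixes, and [t] preserves [P]. *)
Lemma inertia_of_decomposition (t : gal_of {:L}) : in_decomposition P t -> in_inertia P t.
Proof.
move=> tD; split=> // x /residue_int[a Pa]; have := Pa; rewrite tD rmorphB rmorph_nat => Pta.
have -> : t x - x = (t x - a%:R) - (x - a%:R) by rewrite opprB addrA subrK.
by rewrite /P rmorphB; apply: Aint_primeB.
Qed.

(** The Galois group of [M] over Q(zeta_m), which is the inertia group at [p] in [M]. *)
Definition inertiaM : {set gal_of {:M}} := [set s : gal_of {:M} | s wm == wm].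

(** The ratio of [s w] and [t w] is killed by the coprime exponents [p] and [m]. *)
Lemma inertiaM_inj (s t : gal_of {:M}) : s wm = t wm -> s wp = t wp -> s = t.
Proof.
move=> em ep; apply: gal_inj.
have w0 := prim_root_neq0 wP; have tw0 : t w != 0 by rewrite fmorph_eq0.
apply: divr1_eq; set r := s w / t w.
have rp : r ^+ p = 1 by rewrite expr_div_n -!rmorphXn [_ (w ^+ p)]em divff // fmorph_eq0 expf_neq0.
have rm : r ^+ m = 1 by rewrite expr_div_n -!rmorphXn [_ (w ^+ m)]ep divff // fmorph_eq0 expf_neq0.
have [a b e _] := egcdnP m (prime_gt0 pP).
move: e; rewrite (eqP pm) => /(congr1 (GRing.exp r)).
by rewrite mulnC exprM rp expr1n exprD mulnC exprM rm expr1n mul1r expr1.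
Qed.

(** An element is determined by its value at [wp], one of the [p.-1] nontrivial powers of [wp]. *)
Lemma card_inertiaM : (#|inertiaM| <= p.-1)%N.
Proof.
rewrite cardE -(size_map (fun s : gal_of {:M} => s wp)) -(size_iota 1 p.-1).
rewrite -(size_map (GRing.exp wp)); apply: uniq_leq_size.
  rewrite map_inj_in_uniq ?enum_uniq // => s t; rewrite !mem_enum !inE => /eqP sm /eqP tm.
  by apply: inertiaM_inj; rewrite sm tm.
move=> _ /mapP[s _ ->]; have [|i sE] := prim_rootP wp_prim (x := s wp).
  by rewrite -rmorphXn (prim_expr_order wp_prim) rmorph1.
apply/mapP; exists (i : nat) => //.
suff i0 : (i : nat) != 0%N by rewrite mem_iota; have := ltn_ord i; move: i0; clear; lia.
apply/eqP => i0; move: sE; rewrite i0 expr0 -(rmorph1 s) => /fmorph_inj wp1.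
have := prim_order_dvd wp_prim 1; rewrite expr1 wp1 eqxx dvdn1 => /eqP p1.
by have := pP; rewrite p1.
Qed.

Lemma sum_fixed (S : {set gal_of {:M}}) (s : gal_of {:M}) y :
  (forall g, ((g * s)%g \in S) = (g \in S)) -> s (\sum_(g in S) g y) = \sum_(g in S) g y.
Proof.
move=> sS; rewrite rmorph_sum /= [RHS](reindex_inj (mulIg s)) /=.
by apply: eq_big => [g|g _]; rewrite ?sS // galM ?memvf.
Qed.

Lemma prod_fixed (S : {set gal_of {:M}}) (s : gal_of {:M}) y :
  (forall g, ((g * s)%g \in S) = (g \in S)) -> s (\prod_(g in S) g y) = \prod_(g in S) g y.
Proof.
move=> sS; rewrite rmorph_prod /= [RHS](reindex_inj (mulIg s)) /=.
by apply: eq_big => [g|g _]; rewrite ?sS // galM ?memvf.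
Qed.

Lemma PsiM (s t : gal_of {:M}) : Psi (s * t)%g = (Psi s * Psi t)%g.
Proof. by rewrite morphM ?gal_full. Qed.

Lemma wm_orthogonal (s : gal_of {:M}) :
  \sum_(b < m) wm ^- b * s (wm ^+ b) = (s \in inertiaM)%:R * m%:R.
Proof.
under eq_bigr do rewrite rmorphXn /=.
by rewrite prim_root_sum ?wm_prim ?inE // -rmorphXn (prim_expr_order wm_prim) rmorph1.
Qed.

Lemma wmX_Aint b : iota (wm ^- b) \in Aint.
Proof.
have m0 := cofactor_gt0 zpm; apply: (@Aint_unity_root m) => //; apply/unity_rootP.
by rewrite -rmorphXn exprVn exprAC (prim_expr_order wm_prim) expr1n invr1 rmorph1.
Qed.

Lemma gal_wmX_Aint (s : gal_of {:M}) b : iota (s (wm ^+ b)) \in Aint.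
Proof.
have m0 := cofactor_gt0 zpm; apply: (@Aint_unity_root m) => //; apply/unity_rootP.
by rewrite -!rmorphXn exprAC (prim_expr_order wm_prim) expr1n !rmorph1.
Qed.

(* If [Psi s] is not in [T], orthogonality evaluates a sum of elements of the
   prime ideal [A] to [- #|inertiaM| * m], which is prime to [p]. *)
Lemma T_of_inertia (t : gal_of {:L}) : in_inertia P t -> phi t \in T.
Proof.
case=> _ tI; have [s -> sE] := L_lift t.
have [AA AD AM A1 Apr] := AP; have A0 := Aint_prime0 AP Ap.
apply: contraT => sT; pose S := [set g : gal_of {:M} | Psi g \in T].
pose x b := \sum_(g in S) g (wm ^+ b).
have /= xL b : exists y, j y = x b.
  apply: L_fixed => r r1; apply: sum_fixed => g.
  by rewrite !inE PsiM r1 mulg1.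
have Ax b : A (iota (s (x b) - x b)).
  have [y yE] := xL b; rewrite -yE -sE -rmorphB; apply: tI; apply/(alg_intE J).
  by rewrite /J /= yE rmorph_sum rpred_sum // => g _; apply: gal_wmX_Aint.
have : A (iota (\sum_(b < m) wm ^- b * (s (x b) - x b))).
  rewrite rmorph_sum; apply: Aint_prime_sum => // b _; rewrite rmorphM; apply: AM => //.
  exact: wmX_Aint.
have -> : \sum_(b < m) wm ^- b * (s (x b) - x b) = - (#|inertiaM| * m)%:R.
  under eq_bigr do rewrite mulrBr; rewrite big_split /= sumrN.
  (* Orthogonality keeps only products [g * s] in [inertiaM]; these would give [Psi s] in [T]. *)
  have -> : \sum_(b < m) wm ^- b * s (x b) = 0.
    under eq_bigr do rewrite /x rmorph_sum mulr_sumr /=.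
    rewrite exchange_big /= big1 // => g; rewrite inE => gT1.
    under eq_bigr do rewrite -galM ?memvf //.
    rewrite wm_orthogonal; case: (boolP (_ \in _)); rewrite ?mul0r // inE => /eqP/inertia_sub.
    by rewrite PsiM groupMl // (negPf sT).
  rewrite sub0r; congr (- _); under eq_bigr do rewrite /x mulr_sumr.
  rewrite exchange_big /=; under eq_bigr do rewrite wm_orthogonal.
  rewrite -mulr_suml -natr_sum natrM -sum1_card; congr (_%:R * _).
  rewrite big_mkcond [RHS]big_mkcond; apply: eq_bigr => g _.
  rewrite !inE; case: eqP => [/inertia_sub->|] //=; by case: ifP.
rewrite rmorphN rmorph_nat => /(Aint_primeB AP A0); rewrite sub0r opprK.
move/(Aint_prime_nat AP pP Ap); rewrite Euclid_dvdM // => /orP[pI|pdm]; last first.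
  by move: pm; rewrite prime_coprime // pdm.
have I1 : (0 < #|inertiaM|)%N by apply/card_gt0P; exists 1%g; rewrite inE gal_id.
have := leq_trans (dvdn_leq I1 pI) card_inertiaM.
by rewrite leqNgt prednK ?leqnn // prime_gt0.
Qed.

(** * Ramification of [p] in [L] *)

Let H : {set gal_of {:M}} := [set g : gal_of {:M} | Psi g == 1%g].
Let N := H :&: inertiaM.
Let piM := 1 - wp.
(** [H] is the Galois group of [M] over [L] and [N] its inertia part; [nu] is the norm of
    [1 - zeta_p] to the fixed field of [N]. *)
Let nu := \prod_(g in N) g piM.

Lemma inertiaM_mul (g h : gal_of {:M}) :
  h \in inertiaM -> ((g * h)%g \in inertiaM) = (g \in inertiaM).
Proof.
rewrite !inE => /eqP hm; rewrite galM ?memvf //.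
by rewrite -{2}hm (inj_eq (fmorph_inj _)).
Qed.

Lemma H_mul (g h : gal_of {:M}) : h \in H -> ((g * h)%g \in H) = (g \in H).
Proof. by rewrite !inE PsiM => /eqP->; rewrite mulg1. Qed.

Lemma one_in_N : 1%g \in N.
Proof. by rewrite !inE morph1 gal_id !eqxx. Qed.

Lemma gal_piM_ratio (g h : gal_of {:M}) : iota (g piM / h piM) \in Aint.
Proof.
have galp (s : gal_of {:M}) : exists2 i, coprime i p & iota (s piM) = 1 - z ^+ m ^+ i.
  have [|i sE] := prim_rootP wp_prim (x := s wp).
    by rewrite -rmorphXn (prim_expr_order wp_prim) rmorph1.
  exists i; last by rewrite rmorphB rmorph1 /= sE rmorphB rmorph1 /wp !rmorphXn.
  have : p.-primitive_root (s wp) by rewrite fmorph_primitive_root wp_prim.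
  by rewrite sE prim_root_exp_coprime // wp_prim.
have [i _ gE] := galp g; have [k kp hE] := galp h.
by rewrite fmorph_div gE hE; apply: (one_sub_zpX_Aint zpm pP).
Qed.

Lemma piM_neq0 : piM != 0.
Proof. by rewrite -(fmorph_eq0 iota) rmorphB rmorph1 rmorphXn (zp_pi_neq0 zpm pP). Qed.

Lemma nu_neq0 : nu != 0.
Proof. by apply/prodf_neq0 => g _; rewrite fmorph_eq0 piM_neq0. Qed.

Lemma nu_fixed (h : gal_of {:M}) : h \in N -> h nu = nu.
Proof.
rewrite inE => /andP[hH hI]; apply: prod_fixed => g.
by rewrite !in_setI H_mul // inertiaM_mul.
Qed.

Lemma nu_ratio (g h : gal_of {:M}) : iota (g nu / h nu) \in Aint.
Proof.
rewrite /nu !rmorph_prod -prodf_div rmorph_prod rpred_prod // => k _ /=.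
by rewrite -!galM ?memvf //; apply: gal_piM_ratio.
Qed.

Lemma card_N_gt0 : (0 < #|N|)%N.
Proof. by apply/card_gt0P; exists 1%g; apply: one_in_N. Qed.

Hypothesis T_neq1 : exists2 t, t \in T & t != 1%g.

(** A lift [s] in [inertiaM] of a nontrivial element of [T] makes [N] and [N :* s] disjoint subsets
    of [inertiaM]. *)
Lemma card_N : (#|N|.*2 <= p.-1)%N.
Proof.
have [t tT t1] := T_neq1; have [s sI st] := inertia_onto tT.
have sIn : s \in inertiaM by rewrite inE sI.
have dis : N :&: (N :* s)%g = set0.
  apply/setP => g; rewrite in_set0 inE mem_rcoset; apply/negP => /andP[gN].
  rewrite inE => /andP[+ _]; move: gN; rewrite !inE PsiM morphV ?gal_full // st => /andP[/eqP-> _].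
  by rewrite mul1g invg_eq1 (negPf t1).
apply: leq_trans card_inertiaM; rewrite -addnn -{2}(card_rcoset N s) -cardsUI dis cards0 addn0.
apply: subset_leq_card; apply/subsetP => g; rewrite inE mem_rcoset => /orP[|].
  by rewrite inE => /andP[].
by rewrite inE => /andP[_]; rewrite -(inertiaM_mul _ sIn) mulgKV.
Qed.

(** [nu] is [pi ^+ #|N|] up to a unit, and [p] is [pi ^+ p.-1] up to a unit, so [card_N]
    suffices. *)
Lemma p_nu2 : iota (p%:R / nu ^+ 2) \in Aint.
Proof.
have [u [v [zu zv uv pE]]] := p_pi_unit zpm pP; have zA := zeta_Aint zpm.
have nuE : iota nu = pi ^+ #|N| * iota (\prod_(g in N) (g piM / piM)).
  rewrite -[pi]/(1 - z ^+ m) /z -rmorphXn -(rmorph1 iota) -rmorphB -rmorphXn -rmorphM -prodr_const.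
  by rewrite -big_split; congr (iota _); apply: eq_bigr => g _ /=; rewrite mulrC divfK ?piM_neq0.
have rA : iota (\prod_(g in N) (g piM / piM))^-1 \in Aint.
  rewrite -prodfV rmorph_prod rpred_prod // => g _; rewrite invf_div /=.
  by have := gal_piM_ratio 1%g g; rewrite gal_id.
rewrite fmorph_div rmorph_nat rmorphXn nuE pE -/pi.
have pi0 : pi != 0 := zp_pi_neq0 zpm pP.
have -> : p.-1 = ((p.-1 - #|N|.*2) + #|N| * 2)%N by rewrite muln2 subnK // card_N.
rewrite exprD exprM; move: rA; rewrite fmorphV; set r := iota _ => rA.
have r0 : r != 0.
  by rewrite fmorph_eq0; apply/prodf_neq0 => g _; rewrite mulf_neq0 ?invr_eq0 ?fmorph_eq0 ?piM_neq0.
set a := pi ^+ #|N|; set c := pi ^+ _.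
have a0 : a != 0 by rewrite expf_neq0.
have -> : c * a ^+ 2 * u / (a * r) ^+ 2 = c * u * r^-1 ^+ 2 by field; rewrite a0 r0.
rewrite !rpredM ?rpredX //; last exact: (Zadj_Aint zA zu).
by apply: (Zadj_Aint zA); apply: Zadj_pi.
Qed.

(** The trace of [wm ^+ b * nu] from [M] to [L]; [omega b] is its integral quotient by [nu]. *)
Let alpha b := \sum_(h in H) h (wm ^+ b * nu).
Let omega b := alpha b / nu.

Lemma alpha_L b : exists a, j a = alpha b.
Proof.
by apply: L_fixed => r r1; apply: sum_fixed => g; apply: H_mul; rewrite inE r1.
Qed.

Lemma omegaE b : omega b = \sum_(h in H) h (wm ^+ b) * (h nu / nu).
Proof.
by rewrite /omega /alpha mulr_suml; apply: eq_bigr => h _; rewrite rmorphM mulrA.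
Qed.

Lemma omega_Aint b : iota (omega b) \in Aint.
Proof.
rewrite omegaE rmorph_sum rpred_sum // => h _; rewrite rmorphM rpredM ?gal_wmX_Aint //.
by have := nu_ratio h 1%g; rewrite gal_id.
Qed.

(** Orthogonality reduces the sum of the [wm ^- b * omega b] to the terms in [N], where [nu] is
    fixed. The total [#|N| * m] is prime to [p]. *)
Lemma omega_notin : exists b, ~ A (iota (omega b)).
Proof.
have A0 := Aint_prime0 AP Ap; have [_ _ AM _ _] := AP.
apply: boolp.contrapT => nA.
have : A (iota (\sum_(b < m) wm ^- b * omega b)).
  rewrite rmorph_sum; apply: Aint_prime_sum => // b _; rewrite rmorphM; apply: AM.
    exact: wmX_Aint.
  by apply: boolp.contrapT => nAb; apply: nA; exists b.
have -> : \sum_(b < m) wm ^- b * omega b = (#|N| * m)%:R.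
  under eq_bigr do rewrite omegaE mulr_sumr.
  rewrite exchange_big /= natrM -sum1_card natr_sum mulr_suml.
  rewrite big_mkcond [RHS]big_mkcond; apply: eq_bigr => h _.
  rewrite in_setI; case: (boolP (h \in H)) => //= hH.
  have -> : \sum_(b < m) wm ^- b * (h (wm ^+ b) * (h nu / nu)) =
      (\sum_(b < m) wm ^- b * h (wm ^+ b)) * (h nu / nu).
    by rewrite mulr_suml; apply: eq_bigr => b _; exact: mulrA.
  rewrite wm_orthogonal; case: (boolP (h \in inertiaM)) => [hI|]; last by rewrite !mul0r.
  by rewrite nu_fixed ?divff ?nu_neq0 ?mulr1 // in_setI hH.
rewrite rmorph_nat; move/(Aint_prime_nat AP pP Ap); rewrite Euclid_dvdM // => /orP[pN|pdm]; last first.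
  by move: pm; rewrite prime_coprime // pdm.
have := leq_trans (dvdn_leq card_N_gt0 pN) (leq_trans _ card_N).
rewrite -addnn leq_addr => /(_ isT).
by rewrite leqNgt prednK ?leqnn // prime_gt0.
Qed.

Lemma nu_in_A : A (iota nu).
Proof.
have [_ _ AM _ _] := AP; have AZ (h : gal_of {:M}) : A (iota (h piM)).
  have -> : h piM = (h piM / piM) * piM by rewrite divfK ?piM_neq0.
  rewrite rmorphM; apply: AM; last by rewrite rmorphB rmorph1 rmorphXn; apply: pi_in_A.
  by have := gal_piM_ratio h 1%g; rewrite gal_id.
rewrite /nu (bigD1 1%g) ?one_in_N //= mulrC rmorphM; apply: AM; last exact: AZ.
have [AA _ _ _ _] := AP.
by rewrite rmorph_prod rpred_prod // => g _; apply: AA; apply: AZ.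
Qed.

(* [alpha b = omega b * nu] lies in [L], and [omega b] is a unit at [A] for some
   [b]; since [nu ^+ 2] divides [p], so does [alpha b ^+ 2] locally. *)
Lemma p_in_square : ideal_pow P 2 p%:R.
Proof.
have [AA AD AM A1 Apr] := AP; have A0 := Aint_prime0 AP Ap.
have [PA [P0 [PD [PM [P1 [Ppr _]]]]]] := PP.
have [b nb] := omega_notin; have [a aE] := alpha_L b.
have nu0 := nu_neq0.
have om0 : omega b != 0 by apply/eqP => e; apply: nb; rewrite e rmorph0.
have alE : alpha b = omega b * nu by rewrite divfK.
have al0 : alpha b != 0 by rewrite alE mulf_neq0.
have al_fix (h : gal_of {:M}) : h \in H -> h (alpha b) = alpha b.
  by move=> hH; apply: sum_fixed => g; apply: H_mul.
(* [H] fixes [alpha b], so [h] changes [omega b] only by the unit [nu / h nu]. *)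
have hom (h : gal_of {:M}) : h \in H -> h (omega b) = omega b * (nu / h nu).
  by move=> hH; rewrite {1}/omega fmorph_div /= al_fix // alE mulrA.
have homA (h : gal_of {:M}) : h \in H -> iota (h (omega b)) \in Aint.
  move=> /hom->; rewrite rmorphM rpredM ?omega_Aint //.
  by have := nu_ratio 1%g h; rewrite gal_id.
have hom_n (h : gal_of {:M}) : h \in H -> ~ A (iota (h (omega b))).
  move=> hH Ah; apply: nb; have -> : omega b = (h nu / nu) * h (omega b).
    have hnu0 : h nu != 0 by rewrite fmorph_eq0.
    rewrite hom //; move: (h nu) hnu0 => c c0; field; by rewrite nu0 c0.
  rewrite rmorphM; apply: AM => //; by have := nu_ratio h 1%g; rewrite gal_id.
(* The norm of [omega b] lies in [L], is outside [A] and is divisible by [omega b]; it clears the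
   denominator in [t] below. *)
pose s := \prod_(h in H) h (omega b).
have [s0 s0E] : exists s0, j s0 = s.
  by apply: L_fixed => r r1; apply: prod_fixed => g; apply: H_mul; rewrite inE r1.
have sn : ~ A (iota s).
  rewrite /s rmorph_prod.
  suff : \prod_(h in H) iota (h (omega b)) \in Aint /\ ~ A (\prod_(h in H) iota (h (omega b))) by case.
  apply: (big_ind (fun x => x \in Aint /\ ~ A x)) => [|x y [xA nx] [yA ny]|h hH]; first by rewrite rpred1.
    by split; [rewrite rpredM | case/Apr].
  by split; [apply: homA | apply: hom_n].
have sA : iota s \in Aint by rewrite rmorph_prod rpred_prod // => h; apply: homA.
have soA : iota (s / omega b) \in Aint.
  have H1 : 1%g \in H by rewrite inE morph1.
  rewrite /s (bigD1 1%g) //= gal_id mulrC mulKf // rmorph_prod rpred_prod // => h /andP[hH _].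
  exact: homA.
have a0 : a != 0 by rewrite -(fmorph_eq0 j) aE.
have s0int : alg_int s0 by apply/(alg_intE J); rewrite /J /= s0E.
have s0n : ~ P s0 by rewrite /P /J /= s0E.
have Pa : P a.
  rewrite /P /J /= aE alE rmorphM; apply: AM; [exact: omega_Aint | exact: nu_in_A].
pose t := p%:R * s0 ^+ 2 / a ^+ 2.
have tint : alg_int t.
  have jt : j t = p%:R * s ^+ 2 / (omega b * nu) ^+ 2.
    by rewrite fmorph_div rmorphM rmorph_nat !rmorphXn /= aE s0E alE.
  apply/(alg_intE J); rewrite /J /= jt.
  have -> : p%:R * s ^+ 2 / (omega b * nu) ^+ 2 = (p%:R / nu ^+ 2) * (s / omega b) ^+ 2.
    by field; rewrite om0 nu0.
  by rewrite rmorphM rpredM ?p_nu2 // rmorphXn rpredX.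
have tE : p%:R * s0 ^+ 2 = t * a ^+ 2 by rewrite divfK // expf_neq0.
pose e := s0 ^+ 2.
have intX (x : L) i : alg_int x -> alg_int (x ^+ i).
  by move/(alg_intE J) => xA; apply/(alg_intE J); rewrite rmorphXn rpredX.
have intM (x y : L) : alg_int x -> alg_int y -> alg_int (x * y).
  by move=> /(alg_intE J) xA /(alg_intE J) yA; apply/(alg_intE J); rewrite rmorphM rpredM.
have eint : alg_int e by apply: intX.
have en : ~ P e by move/(prime_idealX J PP s0int).
have Q1 := frob_Q_gt1.
have QE : Q = Q.-2.+2 by rewrite -(subnKC Q1).
have Pe : P (1 - e ^+ Q.-1).
  have i1 : alg_int (1 - e ^+ Q.-1).
    apply/(alg_intE J); rewrite rmorphB rmorph1 rmorphXn rpredB ?rpred1 ?rpredX //.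
    by apply/(alg_intE J).
  have : P (e * (1 - e ^+ Q.-1)); last by case/(Ppr _ _ eint i1).
  rewrite mulrBr mulr1 -exprS QE /= /P rmorphB rmorphXn.
  apply: (Aint_prime_dvd AP pi_in_A); rewrite -rpredN opprB -QE.
  by apply: frob_Q; apply/(alg_intE J).
(* Since [e ^+ Q.-1] is [1] modulo [P] and [p * e = t * a ^+ 2], splitting [p] as
   [p * e ^+ Q.-1 + p * (1 - e ^+ Q.-1)] writes it as a sum of two products in the square of [P]. *)
exists [:: (e ^+ Q.-2 * t * a, a); (p%:R, 1 - e ^+ Q.-1)]; split.
  move=> ab; rewrite !inE => /orP[]/eqP-> /=; split=> //.
  - by apply: PM => //; apply: intM => //; apply: intX.
  - exact: ideal_pow1 L_int1 Pa.
  - by rewrite /P rmorph_nat.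
  - exact: ideal_pow1 L_int1 Pe.
have -> : e ^+ Q.-1 = e * e ^+ Q.-2 by rewrite -exprS {1}QE.
rewrite big_cons big_seq1 /=; set c := e ^+ _.
transitivity (c * (t * a ^+ 2) + p%:R * (1 - e * c)); last by ring.
by rewrite -tE -/e; ring.
Qed.

End AtPrime.
End SubCyclotomic.

(** * Tameness and characters *)

Section Tame.
Variables (M L : splittingFieldType rat) (iota : {rmorphism M -> algC}) (j : {rmorphism L -> M}).
Variables (w : M) (n : nat).
Hypotheses (wP : n.-primitive_root w) (wQ : forall x, Qadj (iota w) (iota x)).
Hypothesis n_sqfree : forall q, prime q -> (q %| n)%N -> exists2 m, n = (q * m)%N & coprime q m.

Lemma ramified_dvd q : ramified L q -> (q %| n)%N.
Proof.
case=> qP [P [PP [[_ Pq] P2]]]; apply: contraT => qn.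
by case: (unramified_bound j wP wQ qP qn PP Pq).
Qed.

(** If [q] divided [e] then [e >= q], whereas the index is at most [1] for [q] prime to [n] and at
    most [q.-1] otherwise. *)
Lemma subcyclotomic_tame : tamely_ramified L.
Proof.
move=> P q e PP [qP Pq] [Pe nPe].
have Pow1 := ideal_pow1 (L_int1 iota j) Pq.
have e0 : (0 < e)%N by case: e Pe nPe.
have decr i : (i <= e)%N -> ideal_pow P i q%:R.
  move=> /subnK ei; move: Pe; rewrite -ei; elim: (e - i)%N => // d IH.
  by rewrite addSn => /(ideal_pow_decr PP)/IH.
suff eq : (e < q)%N by rewrite gtnNdvd.
rewrite ltnNge; apply/negP => qe; have [qn|qn] := boolP (q %| n)%N; last first.
  apply: (unramified_bound j wP wQ qP qn PP Pq); apply: decr.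
  exact: leq_trans (prime_gt1 qP) qe.
have [m nE qm] := n_sqfree qP qn.
exact: (ramified_bound j wP wQ nE qP qm PP Pq (decr _ qe)).
Qed.

End Tame.

(** The new prime [p] is chosen so that each earlier prime is an [N]-th power modulo [p], and [p] is
    [1] modulo each earlier prime, hence trivially a power there. *)
Lemma power_residue_primes (N s : nat) : (0 < N)%N ->
  exists ps : seq nat, [/\ size ps = s, uniq ps,
    forall p, p \in ps -> prime p /\ (N %| p.-1)%N &
    forall p q, p \in ps -> q \in ps -> p != q -> exists y, (y ^ N = q %[mod p])%N].
Proof.
move=> N0; elim: s => [|s [ps [sz u psP psR]]]; first by exists [::].
have D0 : (0 < \prod_(q <- ps) q)%N.
  by rewrite big_seq; apply: prodn_cond_gt0 => q /psP[/prime_gt0].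
have dvdD q : q \in ps -> (q %| \prod_(q <- ps) q)%N by move=> qs; rewrite (big_rem q) //= dvdn_mulr.
have ND0 : (0 < N * \prod_(q <- ps) q)%N by rewrite muln_gt0 N0.
have [p [pP pD pN pR]] := prime_split_roots ps ND0 D0.
exists (p :: ps); split; rewrite /= ?sz //.
- by rewrite u andbT; apply: contra pD => /dvdD.
- move=> q; rewrite in_cons => /predU1P[->|/psP //]; split=> //.
  exact: dvdn_trans (dvdn_mulr _ _) pN.
move=> a b; rewrite !in_cons => /predU1P[->|aS] /predU1P[->|bS].
- by rewrite eqxx.
- by move=> _; have [y yE] := pR b bS; exists (y ^ \prod_(q <- ps) q)%N; rewrite -expnM mulnC.
- move=> _; exists 1%N; rewrite exp1n; apply/eqP; rewrite eq_sym eqn_mod_dvd ?prime_gt0 // subn1.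
  exact: dvdn_trans (dvdn_trans (dvdD _ aS) (dvdn_mull _ _)) pN.
- exact: psR.
Qed.

Local Open Scope group_scope.

(** The units of ['F_p] form a cyclic group of order [p.-1]; send a generator to [t]. *)
Lemma Fp_character (gT : finGroupType) (p : nat) (t : gT) : prime p -> (#[t] %| p.-1)%N ->
  exists psi : nat -> gT,
  [/\ forall a, psi a \in <[t]>,
      forall a b, coprime a p -> coprime b p -> psi (a * b)%N = psi a * psi b,
      forall a b, a = b %[mod p] -> psi a = psi b &
      exists2 g, coprime g p & psi g = t].
Proof.
move=> pP tp; have /cyclicP[x xE] := field_unit_group_cyclic [set: {unit 'F_p}]%G.
have tx : (#[t] %| #[x])%N by rewrite [#[x]]orderE -xE card_finField_unit card_Fp.
(* Multiples of [p] get the default unit [1], so the character is defined on all of [nat]. *)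
pose U (a : nat) : {unit 'F_p} := insubd (1 : {unit 'F_p}) (a%:R : 'F_p)%R.
have valU a : coprime a p -> val (U a) = (a%:R)%R.
  move=> ap; rewrite insubdK //= -topredE /= unitfE -[0%R]/((0%N)%:R)%R Fp_nat_eqmod //.
  by rewrite mod0n -[_ == 0%N]/(p %| a)%N -prime_coprime // coprime_sym.
have xU u : u \in <[x]> by rewrite -xE inE.
exists (fun a => eltm tx (U a)); split=> [a|a b ap bp|a b ab|].
- by have := mem_morphim (eltm_morphism tx) (xU (U a)) (xU (U a)); rewrite im_eltm.
- rewrite -(morphM (eltm_morphism tx)) ?xU //; congr (eltm _ _); apply: val_inj.
  by rewrite FinRing.val_unitM !valU ?coprimeMl ?ap // natrM.
- by congr (eltm _ _); congr insubd; apply/eqP; rewrite Fp_nat_eqmod // ab.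
exists (val x : nat).
  rewrite coprime_sym prime_coprime //.
  have : (val x : 'F_p) != 0%R by rewrite -unitfE; apply: valP.
  apply: contra => /dvdnP px; rewrite -(natr_Zp (val x)).
  by rewrite -[0%R]/((0%N)%:R)%R Fp_nat_eqmod // mod0n; apply/dvdnP.
have -> : U (val x) = x.
  by apply: val_inj; rewrite /U natr_Zp valKd.
exact: eltm_id.
Qed.

Lemma prodgM_abelian (gT : finGroupType) (G : {group gT}) (I : Type) (r : seq I) (f g : I -> gT) :
  abelian G -> (forall i, f i \in G) -> (forall i, g i \in G) ->
  \prod_(i <- r) (f i * g i) = (\prod_(i <- r) f i) * (\prod_(i <- r) g i).
Proof.
move=> /centsP cG fG gG; elim: r => [|i r IH]; first by rewrite !big_nil mulg1.
rewrite !big_cons IH !mulgA; congr (_ * _); rewrite -!mulgA; congr (_ * _).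
by apply: cG => //; apply: group_prod.
Qed.

Lemma normal_gen_abelian (gT : finGroupType) (G : {group gT}) (A : {set gT}) :
  abelian G -> A \subset G -> normal_gen G A = <<A>>.
Proof.
move=> /centsP cG AG; rewrite /normal_gen; congr <<_>>; apply/setP => x.
apply/imset2P/idP => [[a g aA gG ->]|xA].
  by rewrite conjgE (cG a _ g gG) ?(subsetP AG) // mulKg.
by exists x 1; rewrite ?group1 // conjg1.
Qed.

(** * Realization *)

Lemma eqmod_dvd (a b m d : nat) : (d %| m)%N -> (a = b %[mod m])%N -> (a = b %[mod d])%N.
Proof. by move=> dm ab; rewrite -(modn_dvdm a dm) ab modn_dvdm. Qed.

(** * The conductor [n] and its cofactors [n / p i] *)

Section Conductor.
Variables (s : nat) (p : 'I_s -> nat).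
Hypotheses (pP : forall i, prime (p i)) (p_inj : injective p).

Definition conductor := (\prod_i p i)%N.
Definition coconductor i := (\prod_(k | k != i) p k)%N.

Lemma conductorE i : conductor = (p i * coconductor i)%N.
Proof. by rewrite /conductor (bigD1 i). Qed.

Lemma conductor_gt0 : (0 < conductor)%N.
Proof. by apply: prodn_gt0 => i; apply: prime_gt0. Qed.

Lemma dvd_coconductor i k : k != i -> (p k %| coconductor i)%N.
Proof. by move=> ki; rewrite /coconductor (bigD1 k) //= dvdn_mulr. Qed.

Lemma dvd_conductor i : (p i %| conductor)%N.
Proof. by rewrite (conductorE i) dvdn_mulr. Qed.

Lemma prime_dvd_conductor q : prime q -> (q %| conductor)%N -> exists i, q = p i.
Proof.
move=> qP; rewrite Euclid_dvd_prod // big_has => /hasP[i _].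
by rewrite dvdn_prime2 // => /eqP; exists i.
Qed.

Lemma coprime_coconductor i : coprime (p i) (coconductor i).
Proof.
rewrite prime_coprime // Euclid_dvd_prod // big_has_cond; apply/hasPn => k _.
by rewrite /= dvdn_prime2 // (inj_eq p_inj) [i == k]eq_sym; case: eqP.
Qed.

End Conductor.

(** * The surjection onto [G] and the field it cuts out *)

Section Realization.
Variables (gT : finGroupType) (G : {group gT}) (s : nat) (t : 'I_s -> gT).
Hypotheses (abG : abelian G) (tG : forall i, t i \in G) (t1 : forall i, t i != 1).
Hypothesis t_gen : <<[set t i | i : 'I_s]>> = G.
Variables (p : 'I_s -> nat) (psi : 'I_s -> nat -> gT).
Hypotheses (pP : forall i, prime (p i)) (p_inj : injective p).
Hypothesis p_res : forall i k, i != k -> exists y, (y ^ #|G| = p k %[mod p i])%N.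
Hypothesis psi_T : forall i a, psi i a \in <[t i]>.
Hypothesis psiM : forall i a b, coprime a (p i) -> coprime b (p i) -> psi i (a * b)%N = psi i a * psi i b.
Hypothesis psi_mod : forall i a b, (a = b %[mod p i])%N -> psi i a = psi i b.
Hypothesis psi_gen : forall i, exists2 g, coprime g (p i) & psi i g = t i.

Let n := conductor p.
Let m := coconductor p.

Lemma psi_G i a : psi i a \in G.
Proof. by apply: subsetP (psi_T i a); rewrite cycle_subG. Qed.

Lemma psi1 i : psi i 1 = 1.
Proof. by apply: (mulgI (psi i 1)); rewrite mulg1 -psiM // coprime1n. Qed.

Lemma psiX i a e : coprime a (p i) -> psi i (a ^ e)%N = psi i a ^+ e.
Proof.
move=> ap; elim: e => [|e IH]; first by rewrite psi1.
by rewrite expnS expgS psiM ?coprimeXl // IH.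
Qed.

(** The map from units modulo [n] onto [G], written on exponents. *)
Definition artin (k : nat) := \prod_(i < s) psi i k.

Lemma artin_mod a b : (a = b %[mod n])%N -> artin a = artin b.
Proof.
move=> ab; apply: eq_bigr => i _; apply: psi_mod; apply: eqmod_dvd ab.
exact: dvd_conductor.
Qed.

Lemma artinM a b : coprime a n -> coprime b n -> artin (a * b)%N = artin a * artin b.
Proof.
move=> an bn; rewrite /artin -(prodgM_abelian _ abG) => [||]; try by move=> i; apply: psi_G.
apply: eq_bigr => i _; apply: psiM; exact: coprime_dvdr (dvd_conductor p i) _.
Qed.

Lemma artin_G k : artin k \in G.
Proof. by apply: group_prod => i _; apply: psi_G. Qed.

Lemma artin_single i k : (forall l, l != i -> psi l k = 1) -> artin k = psi i k.
Proof.
move=> kl; rewrite /artin (eq_bigr (fun l => if l == i then psi i k else 1)) => [|l _].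
  by rewrite -big_mkcond big_pred1_eq.
by case: eqP => [->|/eqP/kl].
Qed.

Lemma artin_inertia i k : (k = 1 %[mod m i])%N -> artin k = psi i k.
Proof.
move=> k1; apply: artin_single => l li; rewrite -(psi1 l); apply: psi_mod.
by apply: eqmod_dvd k1; apply: dvd_coconductor.
Qed.

(** For [l] other than [i], [p i] is a [#|G|]-th power modulo [p l], so [psi l] sends it to [1]; at
    [i] itself [k] is [1]. *)
Lemma artin_frob i k : (k = 1 %[mod p i])%N -> (k = p i %[mod m i])%N -> artin k = 1.
Proof.
move=> ki km; rewrite /artin big1 // => l _; have [->|li] := eqVneq l i.
  by rewrite (psi_mod ki) psi1.
have klp : (k = p i %[mod p l])%N by apply: eqmod_dvd km; apply: dvd_coconductor.
have [y yE] := p_res li; rewrite (psi_mod klp) -(psi_mod yE).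
have yp : coprime y (p l).
  have : coprime (y ^ #|G|) (p l).
    rewrite -coprime_modl yE coprime_modl prime_coprime // dvdn_prime2 // (inj_eq p_inj).
    by rewrite eq_sym.
  by rewrite coprime_pexpl ?cardG_gt0.
by rewrite psiX // expg_cardG // psi_G.
Qed.

Variables (M : splittingFieldType rat) (iota : {rmorphism M -> algC}) (w : M).
Hypotheses (gM : galois 1 {:M}) (wP : (n.-primitive_root w)%R).
Hypotheses (wQ : forall x, Qadj (iota w) (iota x)).
Hypothesis gal_inj : forall s t : gal_of {:M}, s w = t w -> s = t.
Hypothesis gal_ex : forall k, coprime k n -> exists s : gal_of {:M}, s w = (w ^+ k)%R.

Let wX (g : gal_of {:M}) : {k : 'I_n | g w = (w ^+ k)%R}.
Proof.
apply: (prim_rootP wP); rewrite -rmorphXn (prim_expr_order wP); exact: rmorph1.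
Qed.

(** The cyclotomic character, represented by its exponent below [n]. *)
Definition chi (g : gal_of {:M}) : nat := sval (wX g).

Lemma chiE (g : gal_of {:M}) : g w = (w ^+ chi g)%R.
Proof. by rewrite /chi; case: (wX g). Qed.

Lemma chi_coprime (g : gal_of {:M}) : coprime (chi g) n.
Proof.
rewrite -(prim_root_exp_coprime _ wP) -chiE; exact: etrans (fmorph_primitive_root g _ _) wP.
Qed.

Definition artin_gal_fun (g : gal_of {:M}) := artin (chi g).

Lemma artin_gal_funE (g : gal_of {:M}) k : g w = (w ^+ k)%R -> artin_gal_fun g = artin k.
Proof.
by move=> gk; apply: artin_mod; apply/eqP; rewrite -(eq_prim_root_expr wP) -chiE gk.
Qed.

Lemma artin_gal_funM : {in 'Gal({:M} / 1) &, {morph artin_gal_fun : g h / g * h}}.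
Proof.
move=> g h _ _ /=; rewrite -artinM ?chi_coprime //; apply: artin_gal_funE.
by rewrite galM ?memvf // chiE rmorphXn /= chiE -exprM mulnC.
Qed.

Definition artin_gal := Morphism artin_gal_funM.

Let wpm i : ((p i * m i).-primitive_root w)%R.
Proof. by rewrite -(conductorE p i). Qed.

Let wm_prim i : ((m i).-primitive_root (w ^+ p i))%R. Proof. exact: prim_root_exprl. Qed.

Let wp_prim i : ((p i).-primitive_root (w ^+ m i))%R. Proof. exact: prim_root_exprr. Qed.

Let chi_m i (g : gal_of {:M}) k : g (w ^+ p i)%R = (w ^+ p i ^+ k)%R -> (chi g = k %[mod m i])%N.
Proof.
rewrite rmorphXn /= chiE => e; apply/eqP.
by rewrite -(eq_prim_root_expr (wm_prim i)) -e exprAC.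
Qed.

Let chi_p i (g : gal_of {:M}) k : g (w ^+ m i)%R = (w ^+ m i ^+ k)%R -> (chi g = k %[mod p i])%N.
Proof.
rewrite rmorphXn /= chiE => e; apply/eqP.
by rewrite -(eq_prim_root_expr (wp_prim i)) -e exprAC.
Qed.

Lemma artin_gal_inertia_sub i (g : gal_of {:M}) : g (w ^+ p i)%R = (w ^+ p i)%R -> artin_gal g \in <[t i]>.
Proof.
move=> gi; have /chi_m/artin_inertia gE : g (w ^+ p i)%R = (w ^+ p i ^+ 1)%R by rewrite expr1.
by rewrite /= /artin_gal_fun gE psi_T.
Qed.

Lemma artin_gal_inertia_onto i x : x \in <[t i]> ->
  exists2 g : gal_of {:M}, g (w ^+ p i)%R = (w ^+ p i)%R & artin_gal g = x.
Proof.
case/cycleP=> e ->; have [a ap aE] := psi_gen i.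
have pm := coprime_coconductor pP p_inj i.
(* Being [1] modulo [m i] silences every other character, while [psi i] takes the value
   [t i ^+ e]. *)
pose k := chinese (p i) (m i) (a ^ e) 1.
have kp : (k = a ^ e %[mod p i])%N by apply: chinese_modl.
have km : (k = 1 %[mod m i])%N by apply: chinese_modr.
have kn : coprime k n.
  rewrite /n (conductorE p i) coprimeMr -coprime_modl kp coprime_modl coprimeXl //=.
  by rewrite -/(m i) -coprime_modl km coprime_modl coprime1n.
have [g gE] := gal_ex kn; exists g.
  rewrite rmorphXn /= gE exprAC; apply/eqP.
  by rewrite -[X in _ == X]expr1 (eq_prim_root_expr (wm_prim i)) km.
by rewrite /= (artin_gal_funE gE) (artin_inertia km) (psi_mod kp) psiX // aE.
Qed.

Lemma artin_gal_frob i (g : gal_of {:M}) : g (w ^+ m i)%R = (w ^+ m i)%R ->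
  g (w ^+ p i)%R = (w ^+ p i ^+ p i)%R -> artin_gal g = 1.
Proof.
move=> g1 /chi_m gm; apply: artin_frob gm.
by apply: chi_p; rewrite expr1.
Qed.

Lemma artin_gal_onto : artin_gal @* 'Gal({:M} / 1) = G.
Proof.
apply/eqP; rewrite eqEsubset; apply/andP; split.
  by apply/subsetP => _ /morphimP[g _ _ ->]; apply: artin_G.
rewrite -t_gen gen_subG; apply/subsetP => _ /imsetP[i _ ->].
have [g _ <-] := artin_gal_inertia_onto (cycle_id (t i)).
by apply: mem_morphim; rewrite gal_full.
Qed.

Lemma realizable_of_data (T : 'I_s -> {group gT}) :
  (forall i, T i = <[t i]> :> {set gT}) -> realizable_dec G T T.
Proof.
move=> TE; have [L [j [phi [phiI Lfix Llift Lrestr]]]] := quotient_number_field iota gM artin_gal_onto.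
have sqf q : prime q -> (q %| n)%N -> exists2 k, n = (q * k)%N & coprime q k.
  move=> qP /(prime_dvd_conductor pP qP)[i ->]; exists (m i); first exact: conductorE.
  exact: coprime_coconductor.
have /isomP[phi_inj _] := phiI.
exists L, phi; split=> //; split; first exact: (subcyclotomic_tame j wP wQ sqf).
have local i : exists P, [/\ prime_ideal P, lies_over P (p i), ideal_pow P 2 ((p i)%:R : L),
    forall sigma : gal_of {:L}, in_inertia P sigma <-> phi sigma \in T i &
    forall sigma : gal_of {:L}, in_decomposition P sigma <-> phi sigma \in T i].
  have [A [AP Ap]] := Aint_prime_exists (pP i).
  pose J : {rmorphism L -> algC} := (iota \o j)%R.
  have [PP PO] := prime_ideal_contraction J (pP i) AP Ap.
  have pm := coprime_coconductor pP p_inj i.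
  have Isub (g : gal_of {:M}) : g (w ^+ p i)%R = (w ^+ p i)%R -> artin_gal g \in T i.
    by move=> gi; rewrite TE; apply: artin_gal_inertia_sub.
  have Ionto x : x \in T i -> exists2 g : gal_of {:M}, g (w ^+ p i)%R = (w ^+ p i)%R & artin_gal g = x.
    by rewrite TE; apply: artin_gal_inertia_onto.
  have T1 : exists2 x, x \in T i & x != 1 by exists (t i); rewrite ?TE ?cycle_id.
  have IT := inertia_of_T wP wQ (conductorE p i) (pP i) pm AP Ap phi_inj Lrestr Ionto.
  have TI := T_of_inertia wP (conductorE p i) (pP i) pm AP Ap gal_inj Lfix Llift Isub.
  exists (fun x => A (J x)); split=> //.
  - exact: (p_in_square wP wQ (conductorE p i) (pP i) pm AP Ap gal_inj Lfix Ionto T1).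
  - by move=> g; split=> [/TI|/IT].
  move=> g; split=> [gD|/IT[]//].
  apply: TI.
  exact: (inertia_of_decomposition wP wQ (conductorE p i) (pP i) pm AP Ap gal_ex phi_inj
           Lrestr (@artin_gal_frob i) gD).
exists p; split=> //; split=> //; split=> [q|i].
  split=> [rq|[i ->]].
    by case: (rq) => qP _; apply: (prime_dvd_conductor pP qP); apply: (ramified_dvd j wP wQ).
  by have [P [PP PO P2 _ _]] := local i; split=> //; exists P.
by have [P [PP PO _ PI PD]] := local i; exists P.
Qed.

End Realization.

Lemma realizable_split (gT : finGroupType) (G : {group gT}) (s : nat) (T : 'I_s -> {group gT}) :
  abelian G -> tame_ram_config G T -> realizable_dec G T T.
Proof.
move=> abG [[_ rk_min] [TG [Tcyc Tgen]]].
have /fin_all_exists[t tE] : forall i, exists x, T i = <[x]> :> {set gT}.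
  by move=> i; apply/cyclicP.
have tG i : t i \in G by rewrite (subsetP (TG i)) // tE cycle_id.
have TU : \bigcup_(i < s) T i \subset G by apply/bigcupsP.
rewrite normal_gen_abelian // in Tgen.
have sub_gen (B : {set gT}) : (forall i, t i \in <<B>>) -> B \subset G -> <<B>> = G.
  move=> tB BG; apply/eqP; rewrite eqEsubset gen_subG BG /= -{1}Tgen gen_subG.
  by apply/bigcupsP => i _; rewrite tE cycle_subG.
have t_gen : <<[set t i | i : 'I_s]>> = G.
  apply: sub_gen => [i|]; first by rewrite mem_gen // imset_f.
  by apply/subsetP => _ /imsetP[i _ ->].
(* A trivial [t i] could be dropped, generating [G] by [s.-1] elements against the minimality of the
   rank. Nontriviality is what makes [p i] ramify. *)
have t1 i : t i != 1.
  apply/eqP => ti; pose x (k : 'I_s.-1) := t (lift i k).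
  have xG k : x k \in G by apply: tG.
  have xsub : [set x k | k : 'I_s.-1] \subset G by apply/subsetP => _ /imsetP[k _ ->].
  have := rk_min s.-1 x xG; rewrite normal_gen_abelian // sub_gen // => [|l].
    by move/(_ erefl); have := ltn_ord i; clear; lia.
  case: (unliftP i l) => [k ->|->]; last by rewrite ti group1.
  by rewrite mem_gen // -/(x k) imset_f.
have [ps [sz u psP psR]] := power_residue_primes s (cardG_gt0 G).
pose p (i : 'I_s) := nth 0%N ps i.
have pps i : p i \in ps by rewrite mem_nth // sz.
have pP i : prime (p i) by case: (psP _ (pps i)).
have p_inj : injective p.
  by move=> i k /eqP; rewrite nth_uniq ?sz // => /eqP/val_inj.
have /fin_all_exists[psi psiP] i := Fp_character (pP i)
  (dvdn_trans (order_dvdG (tG i)) (proj2 (psP _ (pps i)))).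
have [M [iota [w [gM wP wQ gal_inj gal_ex]]]] := cyclotomic_field (conductor_gt0 pP).
have p_res i k : i != k -> exists y, (y ^ #|G| = p k %[mod p i])%N.
  by move=> ik; apply: psR; rewrite ?(inj_eq p_inj).
have psi1 i := let: And4 h _ _ _ := psiP i in h.
have psi2 i := let: And4 _ h _ _ := psiP i in h.
have psi3 i := let: And4 _ _ h _ := psiP i in h.
have psi4 i := let: And4 _ _ _ h := psiP i in h.
exact: (realizable_of_data abG tG t1 t_gen pP p_inj p_res psi1 psi2 psi3 psi4 gM wP wQ
         gal_inj gal_ex tE).
Qed.

Theorem theorem3p4 (gT : finGroupType) (G : {group gT}) (s : nat) :
  abelian G ->
  (forall T Z : 'I_s -> {group gT}, tame_split_dec_config G T Z -> realizable_dec G T Z) /\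
  (forall T : 'I_s -> {group gT}, tame_ram_config G T -> realizable_ram G T).
Proof.
move=> abG; split=> [T Z [[TR _] ZT]|T TR].
  have [L [phi [phiI [tame [p [p_inj [pP [pR loc]]]]]]]] := realizable_split abG TR.
  exists L, phi; split=> //; split=> //; exists p; split=> //; split=> //; split=> //.
  by move=> i; rewrite ZT.
have [L [phi [phiI [tame [p [p_inj [pP [pR loc]]]]]]]] := realizable_split abG TR.
exists L, phi; split=> //; split=> //; exists p; split=> //; split=> //; split=> // i.
by have [P [PP [PO [PI _]]]] := loc i; exists P.
Qed.
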